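(* Let $X\in\mathbb{P}_m$ and $\mu\in\mathcal{P}^1(\mathbb{P}_m)$. Define $\beta:\mathbb{R}\to\mathbb{P}_m$ by $\beta(t)=G(X\#_t\mu)$. Then $\beta$ is locally Lipschitz continuous on $\mathbb{R}$ and differentiable at $t=0$ with $$\beta'(0)=X^{1/2}\biggl(\int_{\mathbb{P}_m}\log\bigl(X^{-1/2}AX^{-1/2}\bigr)\,d\mu(A)\biggr)X^{1/2}.$$
   Context: $\mathbb{P}_m$ denotes the set of $m\times m$ complex positive definite matrices, with the Riemannian distance $d(A,B)=\|\log(A^{-1/2}BA^{-1/2})\|_2$, where $\|Y\|_2=(\mathrm{tr}\,Y^2)^{1/2}$ for Hermitian $Y$. For $A,B\in\mathbb{P}_m$ and any $t\in\mathbb{R}$, $A\#_tB:=A^{1/2}(A^{-1/2}BA^{-1/2})^tA^{1/2}$. $\mathcal{P}^1(\mathbb{P}_m)$ is the set of Borel probability measures $\mu$ on $\mathbb{P}_m$ with finite first moment, i.e. $\int_{\mathbb{P}_m}d(Z,Y)\,d\mu(Z)<\infty$ for some (equivalently all) $Y\in\mathbb{P}_m$. The Cartan barycenter of $\mu\in\mathcal{P}^1(\mathbb{P}_m)$ is $G(\mu)=\mathrm{arg\,min}_{Z\in\mathbb{P}_m}\int_{\mathbb{P}_m}[d^2(Z,A)-d^2(Y,A)]\,d\mu(A)$ (unique, independent of the fixed $Y\in\mathbb{P}_m$). For $X\in\mathbb{P}_m$, $\mu\in\mathcal{P}^1(\mathbb{P}_m)$ and $t\in\mathbb{R}$, $X\#_t\mu:=(f_t)_*\mu$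 is the push-forward of $\mu$ under the homeomorphism $f_t(A)=X\#_tA$ of $\mathbb{P}_m$ (this lies in $\mathcal{P}^1(\mathbb{P}_m)$). *)

(* Defs.v *)
(* Setting of the paper (Cartan barycenters on the
   cone P_m of m x m complex positive definite matrices). *)
From HB Require Import structures.
From mathcomp Require Import all_boot all_order all_algebra.
From mathcomp Require Import all_classical all_reals all_analysis.
From mathcomp Require Import complex.

Set Implicit Arguments.
Unset Strict Implicit.
Unset Printing Implicit Defensive.

Import Order.TTheory GRing.Theory Num.Theory.
Import numFieldNormedType.Exports.

Local Open Scope classical_set_scope.
Local Open Scope ring_scope.
Local Open Scope sesquilinear_scope.

Section PosDef.
Variables (R : realType) (m : nat).
Local Notation C := R[i].

(* A is Hermitian and v A v^* > 0 for every nonzero row vector v *)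
Definition posdef (A : 'M[C]_m) : Prop :=
  A ^t* = A /\ (forall v : 'rV[C]_m, v != 0 -> 0 < (v *m A *m v ^t*) 0 0).

Lemma posdef1 : posdef 1%:M.
Proof.
split.
  by apply/matrixP => i j; rewrite !mxE conjC_nat eq_sym.
move=> v v0; rewrite mulmx1.
have := @dotmx_is_dotmx C m v v0; by rewrite dotmxE.
Qed.

(* The type P_m *)
Definition PD := {A : 'M[C]_m | `[< posdef A >]}.
HB.instance Definition _ := [Choice of PD by <:].

Definition PD1 : PD := exist _ 1%:M (asboolT posdef1).
HB.instance Definition _ := isPointed.Build PD PD1.

(* Borel sets of P_m, for the topology inherited from 'M[C]_m *)
Definition borelPD : set (set PD) :=
  [set val @^-1` U | U in [set U : set ('M[C]_m : normedModType C) | open U]].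

End PosDef.

(* P_m as a measurable space (its Borel sigma-algebra) *)
Definition Pm (R : realType) (m : nat) := g_sigma_algebraType (@borelPD R m).

Definition pval {R : realType} {m : nat} (A : Pm R m) : 'M[R[i]]_m :=
  val (A : PD R m).

Section MatrixFunctions.
Variables (R : realType) (m : nat).
Local Notation C := R[i].

(* functional calculus through the spectral decomposition
   A = P^-1 diag(d) P (P unitary) of the library *)
Definition mfun (f : R -> R) (A : 'M[C]_m) : 'M[C]_m :=
  invmx (spectralmx A)
  *m diag_mx (\row_i (Complex (f (complex.Re (spectral_diag A 0 i))) 0))
  *m spectralmx A.

(* A^t for real t (on eigenvalues x > 0 : x^t = exp (t ln x)) *)
Definition mpow (A : 'M[C]_m) (t : R) : 'M[C]_m :=
  mfun (fun x => expR (t * ln x)) A.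

(* matrix logarithm *)
Definition mlog (A : 'M[C]_m) : 'M[C]_m := mfun (@ln R) A.

(* A #_t B = A^{1/2} (A^{-1/2} B A^{-1/2})^t A^{1/2} *)
Definition geomean (A B : 'M[C]_m) (t : R) : 'M[C]_m :=
  mpow A (2^-1) *m mpow (mpow A (- 2^-1) *m B *m mpow A (- 2^-1)) t
  *m mpow A (2^-1).

(* ||Y||_2 = (tr Y^2)^{1/2} for Hermitian Y *)
Definition hsnorm (Y : 'M[C]_m) : R := Num.sqrt (complex.Re (\tr (Y *m Y))).

(* Riemannian distance d(A,B) = || log (A^{-1/2} B A^{-1/2}) ||_2 *)
Definition pdist (A B : Pm R m) : R :=
  hsnorm (mlog (mpow (pval A) (- 2^-1) *m pval B *m mpow (pval A) (- 2^-1))).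

(* finite first moment *)
Definition finite_first_moment (mu : set (Pm R m) -> \bar R) : Prop :=
  exists Y : Pm R m, (\int[mu]_(Z in setT) (pdist Z Y)%:E < +oo)%E.

(* real-valued integral *)
Definition rint (mu : set (Pm R m) -> \bar R) (f : Pm R m -> R) : R :=
  fine (\int[mu]_(A in setT) (f A)%:E)%E.

(* entrywise (Bochner) integral of a matrix-valued function *)
Definition mint (mu : set (Pm R m) -> \bar R) (F : Pm R m -> 'M[C]_m)
  : 'M[C]_m :=
  \matrix_(i, j) Complex (rint mu (fun A => complex.Re (F A i j)))
                         (rint mu (fun A => complex.Im (F A i j))).

(* Cartan barycenter: the minimiser over Z of
   int [d^2(Z,A) - d^2(Y,A)] dmu(A), with the fixed base point Y = I *)
Definition cartan_obj (mu : set (Pm R m) -> \bar R) (Z : Pm R m) : R :=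
  rint mu (fun A => pdist Z A ^+ 2 - pdist (PD1 R m) A ^+ 2).

Definition barycenter (mu : set (Pm R m) -> \bar R) : Pm R m :=
  xget (PD1 R m : Pm R m)
    [set G | forall Z : Pm R m, cartan_obj mu G <= cartan_obj mu Z].

(* f_t(A) = X #_t A as a self-map of P_m (X #_t A is positive definite;
   insubd only provides the typing) *)
Definition geomap (X : Pm R m) (t : R) (A : Pm R m) : Pm R m :=
  insubd (X : PD R m) (geomean (pval X) (pval A) t).

(* X #_t mu := (f_t)_* mu *)
Definition geopush (X : Pm R m) (t : R) (mu : set (Pm R m) -> \bar R)
  : set (Pm R m) -> \bar R :=
  pushforward mu (geomap X t).

(* local Lipschitz continuity of a curve in (P_m, d) *)
Definition locally_lipschitz (f : R -> Pm R m) : Prop :=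
  forall t0 : R, exists2 e : R, 0 < e &
    exists L : R, forall s t : R, `|s - t0| < e -> `|t - t0| < e ->
      pdist (f s) (f t) <= L * `|s - t|.

(* f : R -> M_m(C) is differentiable at t with derivative D:
   (f (t + h) - f t) / h --> D as h --> 0, h <> 0 *)
Definition mx_deriv_at (f : R -> 'M[C]_m) (t : R) (D : 'M[C]_m) : Prop :=
  (fun h : R => (Complex h 0)^-1 *: (f (t + h) - f t)
     : ('M[C]_m : normedModType C)) @ 0^' --> (D : ('M[C]_m : normedModType C)).

End MatrixFunctions.

(* Main.v *)
(* Expressed in the eigenbases of H (rows) and K (columns), f(H) - g(K) has entries
   (f(h_i) - g(k_j)) w_ij. With (ln p - ln q)^2 <= p/q + q/p - 2 this bounds
   |log A - log B|_2 by the distance along a short geodesic segment up to higher order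
   terms; subdividing the geodesic from A to B yields the exponential metric increasing
   property |log A - log B|_2 <= d(A, B). Together with congruence invariance it gives
   the triangle inequality, the semiparallelogram law, Reshetnyak's quadruple comparison
   (up to a constant) and the law of cosines.

   The objective is continuous and coercive, so a minimiser exists. The variance
   inequality (from the semiparallelogram law) and the quadruple comparison give
   d(G(h_* mu), G(k_* mu)) <= 3 int d(h, k) dmu, and d(X #_s A, X #_t A) = |s-t| d(X, A).

   For the derivative take X = I for simplicity, L = log A and K = int L dmu. The law of
   cosines based at gamma(t) = exp(tK), integrated and compared with the minimality of
   beta(t), gives
     d(gamma(t), beta(t)) <= 2 int |log(e^{-tK/2} e^{tL} e^{-tK/2}) - t(L - K)| dmu,
   because int (L - K) dmu = 0. The integrand is o(t) by the Lie-Trotter formula and at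
   most 2|t|(|L| + |K|), so the integral is o(t) by dominated convergence. *)
Require Import Defs.
From HB Require Import structures.
From mathcomp Require Import all_boot all_order all_algebra.
From mathcomp Require Import all_classical all_reals all_analysis.
From mathcomp Require Import measurable_realfun complex ring lra.
Import Order.TTheory GRing.Theory Num.Theory.
Import numFieldNormedType.Exports.
Local Open Scope classical_set_scope.
Local Open Scope ring_scope.
Set Implicit Arguments.
Unset Strict Implicit.

(** The geometry is read in charts [cong V H] = V e^H V^* centred at V V^*. Such a chart keeps
    distances to its centre and can only increase the others, so each curvature inequality is a
    Euclidean identity between Hermitian matrices, read in a well-placed chart: at a vertex for the
    triangle inequality, at the midpoint for the semiparallelogram law, at gamma(t) for the law of
    cosines. Any V with V V^* = X serves as a square root of X; replacing V by V e^{sH/2} moves the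
    centre along a geodesic.

    Only a weak quadruple comparison, with a sum of squares in place of a product of distances,
    comes directly from the semiparallelogram law. Subdividing the longer segment balances the two
    squares, at the price of 3 in place of the sharp constant 2.

    Two gaps remain to be bridged. The sigma-algebra and the derivative refer to the entrywise
    topology, the estimates to d, so the two are compared locally in both directions. The
    Lie-Trotter remainder is not uniform in A, so the limit passes through a sequence of parameters
    and a dominated integral. *)

(** * Scalar inequalities for exp and ln *)

Section ScalarInequalities.
Variable R : realType.
Implicit Types x y : R.

Lemma expR_sinh_ge y : 0 <= y -> 2 * y <= expR y - expR (- y).
Proof.
move=> y0; pose f x : R := expR x - expR (- x) - 2 * x.
have df x : is_derive x 1 f (expR x + expR (- x) - 2).
  rewrite /f; apply: is_derive_eq; rewrite ?scaler0 ?addr0 /=.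
  rewrite /GRing.scale /=; ring.
have f1 x : derive1 f x = expR x + expR (- x) - 2 by rewrite derive1E; apply: derive_val.
have : f 0 <= f y.
  apply: (@ger0_derive1_ndecry _ f 0) => //.
  - by move=> x _; rewrite f1; have := expR_ge1Dx x; have := expR_ge1Dx (- x); lra.
  - by apply: derivable_within_continuous => x _.
by rewrite /f oppr0; lra.
Qed.

(** The right side is e^x + e^{-x} - 2. It is kept as a square because it arises as the squared
    entry of a difference of two products of half powers. *)
Lemma sqr_le_cosh x : x ^+ 2 <= (expR (x / 2) - expR (- (x / 2))) ^+ 2.
Proof.
wlog x0 : x / 0 <= x.
  move=> h; have [/h //|/ltW x0] := leP 0 x.
  have := h (- x); rewrite oppr_ge0 => /(_ x0); rewrite sqrrN mulNr opprK.
  by rewrite -[X in _ <= X ^+ 2]opprB sqrrN.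
have := @expR_sinh_ge (x / 2); rewrite divr_ge0 // => /(_ isT) h.
by rewrite ler_sqr ?nnegrE //; [lra|lra].
Qed.

(** For x >= 0 this is 1 - e^{-x} <= x, multiplied by e^{x/2} and squared. The exponential factor
    tends to 1 with x, which is what subdividing a geodesic exploits. *)
Lemma cosh_le_sqr x :
  (expR (x / 2) - expR (- (x / 2))) ^+ 2 <= x ^+ 2 * expR `|x|.
Proof.
wlog x0 : x / 0 <= x.
  move=> h; have [/h //|/ltW x0] := leP 0 x.
  have := h (- x); rewrite oppr_ge0 => /(_ x0); rewrite sqrrN mulNr opprK normrN.
  by rewrite -[X in X ^+ 2 <= _ -> _]opprB sqrrN.
rewrite ger0_norm //.
have -> : expR x = expR (x / 2) ^+ 2 by rewrite -expRM_natl; congr expR; lra.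
rewrite -exprMn ler_sqr ?nnegrE ?mulr_ge0 ?expR_ge0 //; last first.
  by rewrite subr_ge0 ler_expR; lra.
have -> : expR (- (x / 2)) = expR (x / 2) * expR (- x).
  by rewrite -expRD; congr expR; lra.
have := expR_ge1Dx (- x); have := expR_gt0 (x / 2).
nra.
Qed.

Lemma expR_lipschitz x y (k : R) : x <= k -> y <= k ->
  `|expR x - expR y| <= expR k * `|x - y|.
Proof.
wlog xy : x y / y <= x.
  move=> h xk yk; have [/h|/ltW /h] := leP y x; first exact.
  by rewrite distrC [`|x - y|]distrC; exact.
move=> xk yk; rewrite !ger0_norm ?subr_ge0 ?ler_expR //.
have -> : expR y = expR x * expR (y - x) by rewrite -expRD; congr expR; lra.
have := expR_ge1Dx (y - x); have := expR_gt0 x.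
have : expR x <= expR k by rewrite ler_expR.
nra.
Qed.

Lemma expR_taylor1 x : `|expR x - 1 - x| <= x ^+ 2 * expR `|x|.
Proof.
rewrite ger0_norm; last by have := expR_ge1Dx x; lra.
have [x0|x0] := leP 0 x.
  rewrite ger0_norm //; have := expR_ge1Dx (- x).
  have : expR x * expR (- x) = 1 by rewrite -expRD subrr expR0.
  move=> ee e'; have e1 : expR x - 1 <= x * expR x.
    have := expR_gt0 x; nra.
  have := ler_wpM2l x0 e1; nra.
rewrite ltr0_norm //; have := expR_ge1Dx (- x).
have : expR x * expR (- x) = 1 by rewrite -expRD subrr expR0.
have := expR_ge1Dx x; have := expR_gt0 x; nra.
Qed.

(** The bounds 1 - 1/x <= ln x <= x - 1 enclose ln x, and the constant 2 is the bound of 1/x on x >=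
    1/2. *)
Lemma ln_taylor0 x : `|x - 1| <= 2^-1 -> `|ln x| <= 2 * `|x - 1|.
Proof.
rewrite ler_norml => /andP[x1 x2]; have x0 : 0 < x by lra.
have := @le_ln1Dx _ (x - 1); rewrite (addrC 1) subrK => /(_ ltac:(lra)) h1.
have h2 : 1 - x^-1 <= ln x.
  have := @le_ln1Dx _ (x^-1 - 1); rewrite (addrC 1) subrK lnV ?posrE //.
  have := invr_gt0 x; rewrite x0 => ? /(_ ltac:(lra)); lra.
have xV : x * x^-1 = 1 by rewrite divff ?gt_eqF.
have xi : x^-1 <= 2 by rewrite invf_ple ?posrE //; lra.
rewrite ler_norml; have [x11|x11] := leP 0 (x - 1).
  by rewrite ger0_norm //; apply/andP; split; nra.
by rewrite ltr0_norm //; apply/andP; split; nra.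
Qed.

Lemma ln_taylor1 x : `|x - 1| <= 2^-1 -> `|ln x - (x - 1)| <= 2 * (x - 1) ^+ 2.
Proof.
rewrite ler_norml => /andP[x1 x2]; have x0 : 0 < x by lra.
have := @le_ln1Dx _ (x - 1); rewrite (addrC 1) subrK => /(_ ltac:(lra)) h1.
have h2 : 1 - x^-1 <= ln x.
  have := @le_ln1Dx _ (x^-1 - 1); rewrite (addrC 1) subrK lnV ?posrE //.
  have := invr_gt0 x; rewrite x0 => ? /(_ ltac:(lra)); lra.
have xV : x * x^-1 = 1 by rewrite divff ?gt_eqF.
have xi : x^-1 <= 2 by rewrite invf_ple ?posrE //; lra.
have xi0 : 0 < x^-1 by rewrite invr_gt0.
have h3 : (x - 1) - (1 - x^-1) = (x - 1) ^+ 2 * x^-1.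
  by rewrite expr2; field; rewrite gt_eqF.
have := ler_wpM2l (sqr_ge0 (x - 1)) xi.
rewrite ler_norml => ?; apply/andP; split; nra.
Qed.

End ScalarInequalities.

(* The matrix analysis is carried out over an abstract model of [R[i]]: on the
   concrete type, comparing two matrix products unfolds the complex arithmetic. *)
Record complexification (R : realType) := Complexification {
  cfield :> numClosedFieldType;
  rc : {rmorphism R -> cfield};
  re : cfield -> R;
  im : cfield -> R;
  mkc : R -> R -> cfield;
  re_mkc : forall a b, re (mkc a b) = a;
  im_mkc : forall a b, im (mkc a b) = b;
  reD : forall x y, re (x + y) = re x + re y;
  imD : forall x y, im (x + y) = im x + im y;
  reZ : forall r x, re (rc r * x) = r * re x;
  imZ : forall r x, im (rc r * x) = r * im x;
  re_rc : forall r, re (rc r) = r;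
  re_conj : forall x, re (Num.conj x) = re x;
  im_conj : forall x, im (Num.conj x) = - im x;
  re_mulJ : forall x y, re (x * Num.conj y) = re x * re y + im x * im y;
  conj_rc : forall r, Num.conj (rc r) = rc r;
  re_im0 : forall x, re x = 0 -> im x = 0 -> x = 0;
  rcK : forall x, x \is Num.real -> rc (re x) = x;
  rc_le : forall r s, (rc r <= rc s) = (r <= s);
  rc_lt : forall r s, (rc r < rc s) = (r < s)
}.

(** * The complex numbers as an instance of the model *)

Section ConcreteComplex.
Variable R : realType.
Local Notation C := R[i].

Lemma complex_ReD (x y : C) : complex.Re (x + y) = complex.Re x + complex.Re y.
Proof. by case: x; case: y. Qed.

Lemma complex_ImD (x y : C) : complex.Im (x + y) = complex.Im x + complex.Im y.
Proof. by case: x; case: y. Qed.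

Lemma complex_ReZ (r : R) (x : C) :
  complex.Re (real_complex R r * x) = r * complex.Re x.
Proof. by case: x => a b /=; rewrite mul0r subr0. Qed.

Lemma complex_ImZ (r : R) (x : C) :
  complex.Im (real_complex R r * x) = r * complex.Im x.
Proof. by case: x => a b /=; rewrite mul0r addr0. Qed.

Lemma complex_Re_conj (x : C) : complex.Re (Num.conj x) = complex.Re x.
Proof. by case: x. Qed.

Lemma complex_Im_conj (x : C) : complex.Im (Num.conj x) = - complex.Im x.
Proof. by case: x. Qed.

Lemma complex_Re_mulJ (x y : C) : complex.Re (x * Num.conj y) =
  complex.Re x * complex.Re y + complex.Im x * complex.Im y.
Proof. by case: x => a b; case: y => c d /=; rewrite mulrN opprK. Qed.

Lemma complex_conj_real (r : R) : Num.conj (real_complex R r : C) = real_complex R r.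
Proof. exact: conjc_real. Qed.

Lemma complex_Re_Im0 (x : C) : complex.Re x = 0 -> complex.Im x = 0 -> x = 0.
Proof. by case: x => a b /= -> ->. Qed.

Definition complex_model : complexification R :=
  @Complexification R (R[i] : numClosedFieldType) (real_complex R) _ _
    (fun a b => Complex a b : R[i]) (fun _ _ => erefl) (fun _ _ => erefl) complex_ReD complex_ImD
    complex_ReZ complex_ImZ (fun=> erefl) complex_Re_conj complex_Im_conj
    complex_Re_mulJ complex_conj_real complex_Re_Im0 (@RRe_real R)
    (@lecR R) (@ltcR R).

End ConcreteComplex.

(** * Hermitian matrices, functional calculus and the Hilbert-Schmidt norm *)

Section HermitianMatrices.
Local Open Scope sesquilinear_scope.
Variables (R : realType) (C : complexification R) (m : nat).
Local Notation M := 'M[C]_m.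
Local Notation "x %:C" := (rc C x) : ring_scope.
Implicit Types (A B H K U V W : M) (d e : 'I_m -> R) (f g : R -> R).

Definition herm A := A ^t* = A.

Definition rdiag d : M := diag_mx (\row_i (d i)%:C).

Definition spec A (i : 'I_m) : R := re (spectral_diag A 0 i).

Lemma adjM A B : (A *m B) ^t* = B ^t* *m A ^t*.
Proof. by rewrite trmx_mul map_mxM. Qed.

Lemma adjD A B : (A + B) ^t* = A ^t* + B ^t*.
Proof. by rewrite linearD /= map_mxD. Qed.

Lemma adjN A : (- A) ^t* = - A ^t*.
Proof. by rewrite linearN /= map_mxN. Qed.

Lemma adjZ (r : R) A : (r%:C *: A) ^t* = r%:C *: A ^t*.
Proof. by rewrite linearZ /= map_mxZ /= conj_rc. Qed.

Lemma adj1 : (1%:M : M) ^t* = 1%:M.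
Proof. by rewrite trmx1 map_mx1. Qed.

Lemma adj_rdiag d : (rdiag d) ^t* = rdiag d.
Proof.
rewrite /rdiag tr_diag_mx map_diag_mx; congr diag_mx.
by apply/rowP => i; rewrite !mxE; exact: conj_rc.
Qed.

Lemma adj_unit V : V \in unitmx -> V ^t* \in unitmx.
Proof. by move=> Vu; rewrite map_unitmx unitmx_tr. Qed.

Lemma adj_inv V : V \in unitmx -> (invmx V) ^t* = invmx (V ^t*).
Proof. by move=> Vu; rewrite trmx_inv map_invmx. Qed.

Lemma rdiagM d e : rdiag d *m rdiag e = rdiag (fun i => d i * e i).
Proof.
rewrite mulmx_diag; congr diag_mx; apply/rowP => i.
by rewrite !mxE rmorphM.
Qed.

Lemma rdiagD d e : rdiag d + rdiag e = rdiag (fun i => d i + e i).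
Proof.
rewrite /rdiag -raddfD; congr diag_mx; apply/rowP => i.
by rewrite !mxE rmorphD.
Qed.

Lemma eq_rdiag d e : d =1 e -> rdiag d = rdiag e.
Proof. by move=> de; congr diag_mx; apply/rowP => i; rewrite !mxE de. Qed.

Lemma rdiag_const (r : R) : rdiag (fun=> r) = r%:C%:M.
Proof.
by apply/matrixP => i j; rewrite !mxE.
Qed.

Lemma hermP A : herm A <-> A \is hermsymmx.
Proof.
split=> [hA|/is_hermitianmxP]; last by rewrite expr0 scale1r.
by apply/is_hermitianmxP; rewrite expr0 scale1r hA.
Qed.

Lemma spec_unitary A : spectralmx A *m (spectralmx A) ^t* = 1%:M.
Proof. by apply/unitarymxP/spectral_unitarymx. Qed.

Lemma invmx_spec A : invmx (spectralmx A) = (spectralmx A) ^t*.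
Proof. by apply/invmx_unitary/spectral_unitarymx. Qed.

Lemma unitaryC U : U *m U ^t* = 1%:M -> U ^t* *m U = 1%:M.
Proof. exact: mulmx1C. Qed.

Lemma unitary_unit U : U *m U ^t* = 1%:M -> U \in unitmx.
Proof. by case/mulmx1_unit. Qed.

Lemma spec_unitaryC A : (spectralmx A) ^t* *m spectralmx A = 1%:M.
Proof. exact/unitaryC/spec_unitary. Qed.

Lemma herm_spectral A : herm A ->
  A = (spectralmx A) ^t* *m rdiag (spec A) *m spectralmx A.
Proof.
move=> /hermP hA; have /hermitian_normalmx /orthomx_spectralP Ae := hA.
rewrite {1}Ae invmx_spec; congr (_ *m _ *m _); congr diag_mx.
apply/rowP => i; rewrite !mxE.
by have /mxOverP/(_ 0 i)/rcK <- := hermitian_spectral_diag_real hA.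
Qed.

Lemma spectral_mul A : herm A -> spectralmx A *m A = rdiag (spec A) *m spectralmx A.
Proof. by move=> hA; rewrite {2}(herm_spectral hA) !mulmxA spec_unitary mul1mx. Qed.

(* Locked: otherwise matching a pattern [_ *m _] unfolds the functional calculus. *)
Fact gfun_key : unit. Proof. by []. Qed.
Definition gfun f A : M := locked_with gfun_key
  (invmx (spectralmx A)
   *m diag_mx (\row_i (f (re (spectral_diag A 0 i)))%:C)
   *m spectralmx A).

Lemma gfunE f A :
  gfun f A = (spectralmx A) ^t* *m rdiag (fun i => f (spec A i)) *m spectralmx A.
Proof. by rewrite /gfun unlock invmx_spec. Qed.

(** Two diagonalisations of A are intertwined by W = P V^{-1}, whose entry (i, j) vanishes unless
    l_i = d_j; so W also intertwines f(l) and f(d). The calculus can thus be computed from any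
    diagonalising V, unitary or not, which gives composition and unitary conjugation. *)
Lemma gfun_uniq f A V d : herm A -> V \in unitmx -> V *m A = rdiag d *m V ->
  gfun f A = invmx V *m rdiag (fun i => f (d i)) *m V.
Proof.
move=> hA Vu VA; set P := spectralmx A; set l := spec A.
have PA : P *m A = rdiag l *m P by exact: spectral_mul.
pose W := P *m invmx V.
have lW : rdiag l *m W = W *m rdiag d.
  rewrite /W mulmxA -PA -!mulmxA; congr (_ *m _).
  by rewrite -[rdiag d](mulmxK Vu) -VA mulmxA mulKmx.
have flW : rdiag (fun i => f (l i)) *m W = W *m rdiag (fun i => f (d i)).
  apply/matrixP => i j; have /matrixP/(_ i j) := lW.
  rewrite !mul_diag_mx !mul_mx_diag !mxE => /eqP.
  rewrite mulrC -subr_eq0 -mulrBr mulf_eq0 subr_eq0 => /orP[/eqP->|/eqP].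
    by rewrite mulr0 mul0r.
  by move=> /fmorph_inj ->; rewrite mulrC.
rewrite gfunE -/P -/l.
have PW : P = W *m V by rewrite mulmxKV.
rewrite {2}PW mulmxA -(mulmxA (P ^t*)) flW mulmxA; congr (_ *m _ *m _).
by rewrite /W mulmxA spec_unitaryC mul1mx.
Qed.

Lemma adj_gfun f A : herm (gfun f A).
Proof. by rewrite /herm gfunE !adjM adj_rdiag trmxCK mulmxA. Qed.

Lemma gfun_spectral f A :
  spectralmx A *m gfun f A = rdiag (fun i => f (spec A i)) *m spectralmx A.
Proof. by rewrite gfunE !mulmxA spec_unitary mul1mx. Qed.

Lemma gfun_comp f g A : gfun f (gfun g A) = gfun (fun x => f (g x)) A.
Proof.
rewrite (gfun_uniq f (adj_gfun g A) (spectral_unit A) (gfun_spectral g A)).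
by rewrite gfunE invmx_spec.
Qed.

Lemma eq_gfun f g A : (forall i, f (spec A i) = g (spec A i)) ->
  gfun f A = gfun g A.
Proof.
by move=> fg; rewrite !gfunE; congr (_ *m _ *m _); apply: eq_rdiag.
Qed.

Lemma gfunM f g A : gfun f A *m gfun g A = gfun (fun x => f x * g x) A.
Proof.
rewrite !gfunE -rdiagM !mulmxA; congr (_ *m _); rewrite -!mulmxA.
by rewrite (mulmxA (spectralmx A)) spec_unitary mul1mx.
Qed.

Lemma gfunD f g A : gfun f A + gfun g A = gfun (fun x => f x + g x) A.
Proof. by rewrite !gfunE -rdiagD mulmxDr mulmxDl. Qed.

Lemma gfun_const (r : R) A : gfun (fun=> r) A = r%:C%:M.
Proof. by rewrite gfunE rdiag_const mul_mx_scalar -scalemxAl spec_unitaryC scalemx1. Qed.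

Lemma gfun_id A : herm A -> gfun id A = A.
Proof. by move=> hA; rewrite gfunE -herm_spectral. Qed.

Lemma gfunZ (r : R) A : herm A -> gfun ( *%R r) A = r%:C *: A.
Proof.
move=> hA; rewrite -[in RHS](gfun_id hA) -mul_scalar_mx -(gfun_const r A) gfunM.
exact: eq_gfun.
Qed.

Lemma gfun_conj f A U : herm A -> U *m U ^t* = 1%:M ->
  gfun f (U *m A *m U ^t*) = U *m gfun f A *m U ^t*.
Proof.
move=> hA UU; have hUA : herm (U *m A *m U ^t*).
  by rewrite /herm !adjM trmxCK hA mulmxA.
have UU' := unitaryC UU.
have Vu : spectralmx A *m U ^t* \in unitmx.
  by rewrite unitmx_mul spectral_unit adj_unit // unitary_unit.
rewrite (@gfun_uniq f _ _ (spec A) hUA Vu).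
  have -> : invmx (spectralmx A *m U ^t*) = U *m (spectralmx A) ^t*.
    apply: (can_inj (mulKmx Vu)); rewrite mulmxV // !mulmxA.
    by rewrite -(mulmxA _ (U ^t*)) UU' mulmx1 spec_unitary.
  by rewrite gfunE !mulmxA.
rewrite !mulmxA -[_ *m U ^t* *m U]mulmxA UU' mulmx1; congr (_ *m _).
exact: spectral_mul.
Qed.

Lemma herm_conj A U : herm A -> herm (U *m A *m U ^t*).
Proof. by move=> hA; rewrite /herm !adjM trmxCK hA mulmxA. Qed.

Lemma hermN A : herm A -> herm (- A).
Proof. by rewrite /herm adjN => ->. Qed.

Lemma hermZ (r : R) A : herm A -> herm (r%:C *: A).
Proof. by rewrite /herm adjZ => ->. Qed.

Lemma herm0 : herm 0.
Proof. by rewrite /herm trmx0 map_mx0. Qed.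

Lemma herm1 : herm 1%:M.
Proof. exact: adj1. Qed.

(** * The Hilbert-Schmidt inner product *)

Definition ip A B : R := re (\tr (A *m B ^t*)).

Definition N A : R := Num.sqrt (ip A A).

Lemma re0 : re (0 : C) = 0.
Proof. by rewrite -(rmorph0 (rc C)) re_rc. Qed.

Lemma im0 : im (0 : C) = 0.
Proof. by apply: (addrI (im (0 : C))); rewrite -imD !addr0. Qed.

Lemma reN (x : C) : re (- x) = - re x.
Proof. by apply: (addrI (re x)); rewrite -reD !subrr re0. Qed.

Lemma imN (x : C) : im (- x) = - im x.
Proof. by apply: (addrI (im x)); rewrite -imD !subrr im0. Qed.

Lemma re_sum (I : finType) (F : I -> C) :
  re (\sum_i F i) = \sum_i re (F i).
Proof. by elim/big_rec2: _ => [|i y x _ <-]; rewrite ?re0 ?reD. Qed.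

Lemma ipE A B : ip A B = \sum_i \sum_j
  (re (A i j) * re (B i j) + im (A i j) * im (B i j)).
Proof.
rewrite /ip /mxtrace re_sum; apply: eq_bigr => i _.
rewrite mxE re_sum; apply: eq_bigr => j _.
by rewrite !mxE re_mulJ.
Qed.

Lemma ipC A B : ip A B = ip B A.
Proof.
by rewrite !ipE; apply: eq_bigr => i _; apply: eq_bigr => j _; rewrite mulrC [X in _ + X]mulrC.
Qed.

Lemma ipDl A B K : ip (A + B) K = ip A K + ip B K.
Proof. by rewrite /ip mulmxDl linearD /= reD. Qed.

Lemma ipNl A B : ip (- A) B = - ip A B.
Proof. by rewrite /ip mulNmx linearN /= reN. Qed.

Lemma ipZl (r : R) A B : ip (r%:C *: A) B = r * ip A B.
Proof. by rewrite /ip -scalemxAl linearZ /= reZ. Qed.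

Lemma ipDr A B K : ip K (A + B) = ip K A + ip K B.
Proof. by rewrite ipC ipDl ![ip _ K]ipC. Qed.

Lemma ipNr A B : ip B (- A) = - ip B A.
Proof. by rewrite ipC ipNl ipC. Qed.

Lemma ipZr (r : R) A B : ip B (r%:C *: A) = r * ip B A.
Proof. by rewrite ipC ipZl ipC. Qed.

Lemma ip_ge0 A : 0 <= ip A A.
Proof.
rewrite ipE; apply: sumr_ge0 => i _; apply: sumr_ge0 => j _.
by rewrite -!expr2 addr_ge0 ?sqr_ge0.
Qed.

Lemma N_ge0 A : 0 <= N A.
Proof. exact: sqrtr_ge0. Qed.

Lemma N2 A : N A ^+ 2 = ip A A.
Proof. by rewrite sqr_sqrtr // ip_ge0. Qed.

Lemma N_entry A i j : `|re (A i j)| <= N A /\ `|im (A i j)| <= N A.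
Proof.
have key (x : R) : x ^+ 2 <= N A ^+ 2 -> `|x| <= N A.
  by rewrite -real_normK ?num_real // ler_sqr ?nnegrE // N_ge0.
have le2 : re (A i j) ^+ 2 + im (A i j) ^+ 2 <= N A ^+ 2.
  rewrite N2 ipE (bigD1 i) //= (bigD1 j) //= -!expr2 -addrA lerDl.
  by rewrite addr_ge0 //; repeat (apply: sumr_ge0 => ? _);
    rewrite -!expr2 addr_ge0 ?sqr_ge0.
by split; apply: key; apply: le_trans le2; rewrite ?lerDl ?lerDr sqr_ge0.
Qed.

Lemma N0_eq0 A : N A = 0 -> A = 0.
Proof.
move=> A0; apply/matrixP => i j; have [] := N_entry A i j.
by rewrite A0 !normr_le0 mxE => /eqP ? /eqP ?; apply: re_im0.
Qed.

Lemma N_Cauchy_Schwarz A B : ip A B <= N A * N B.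
Proof.
have [A0|A0] := eqVneq (N A) 0.
  have -> : A = 0 by exact: N0_eq0.
  by rewrite ipE big1 ?mulr_ge0 ?N_ge0 // => i _; rewrite big1 // => j _; rewrite mxE re0 im0 !mul0r addr0.
have Ap : 0 < N A by rewrite lt_def A0 N_ge0.
(* The squared norm of |B| A - |A| B expands to 2 |A| |B| (|A| |B| - <A, B>). *)
have := ip_ge0 ((N B)%:C *: A - (N A)%:C *: B).
rewrite !(ipDl, ipDr, ipNl, ipNr, ipZl, ipZr) -!N2 [ip B A]ipC.
have [B0|B0] := eqVneq (N B) 0.
  have -> : B = 0 by exact: N0_eq0.
  by rewrite ipC ipE big1 ?mulr_ge0 ?N_ge0 // => i _; rewrite big1 // => j _; rewrite mxE re0 im0 !mul0r addr0.
have Bp : 0 < N B by rewrite lt_def B0 N_ge0.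
move=> h; rewrite -(ler_pM2l (mulr_gt0 Ap Bp)).
nra.
Qed.

Lemma N_triangle A B : N (A + B) <= N A + N B.
Proof.
rewrite -(@ler_sqr _ (N (A + B))) ?nnegrE ?addr_ge0 ?N_ge0 // sqrrD !N2 ipDl !ipDr [ip B A]ipC.
have := N_Cauchy_Schwarz A B; lra.
Qed.

Lemma NN A : N (- A) = N A.
Proof. by rewrite /N ipNl ipNr opprK. Qed.

Lemma NZ (r : R) A : N (r%:C *: A) = `|r| * N A.
Proof. by rewrite /N ipZl ipZr mulrA -expr2 sqrtrM ?sqr_ge0 // sqrtr_sqr. Qed.

Lemma N0 : N 0 = 0.
Proof. by have := NZ 0 0; rewrite rmorph0 scale0r normr0 mul0r. Qed.

Lemma N_dist A B : `|N A - N B| <= N (A - B).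
Proof.
have := N_triangle (A - B) B; have := N_triangle (B - A) A.
rewrite !subrK -[B - A]opprB NN ler_norml; lra.
Qed.

Lemma N_adj A : N (A ^t*) = N A.
Proof.
congr Num.sqrt; rewrite !ipE exchange_big; apply: eq_bigr => i _; apply: eq_bigr => j _.
by rewrite !mxE re_conj im_conj mulrNN.
Qed.

Lemma N_unitaryl U A : U *m U ^t* = 1%:M -> N (U *m A) = N A.
Proof.
move=> UU; rewrite /N /ip adjM mulmxA mxtrace_mulC !mulmxA (unitaryC UU).
by rewrite mul1mx.
Qed.

Lemma N_unitaryr U A : U *m U ^t* = 1%:M -> N (A *m U) = N A.
Proof. by move=> UU; rewrite /N /ip adjM mulmxA -(mulmxA A) UU mulmx1. Qed.

Lemma N2_sum A : N A ^+ 2 =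
  \sum_i \sum_j (re (A i j) ^+ 2 + im (A i j) ^+ 2).
Proof. by rewrite N2 ipE. Qed.

End HermitianMatrices.

(** * Spectral norm estimates, exponential and logarithm of positive definite matrices *)

Section PositiveMatrices.
Local Open Scope sesquilinear_scope.
Variables (R : realType) (C : complexification R) (m : nat).
Local Notation M := 'M[C]_m.
Local Notation "x %:C" := (rc C x) : ring_scope.
Implicit Types (A B H K U V W : M) (d e : 'I_m -> R) (f g : R -> R).

Lemma rc_ge0 (x : R) : (0 <= x%:C) = (0 <= x).
Proof. by rewrite -(rmorph0 (rc C)) rc_le. Qed.

Lemma rc_gt0 (x : R) : (0 < x%:C) = (0 < x).
Proof. by rewrite -(rmorph0 (rc C)) rc_lt. Qed.

Lemma tr_gfun f A : re (\tr (gfun f A)) = \sum_i f (spec A i).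
Proof.
rewrite gfunE mxtrace_mulC mulmxA spec_unitary mul1mx mxtrace_diag re_sum.
by apply: eq_bigr => i _; rewrite mxE re_rc.
Qed.

Lemma N2_gfun f A : N (gfun f A) ^+ 2 = \sum_i f (spec A i) ^+ 2.
Proof. by rewrite N2 /ip (adj_gfun f A) gfunM tr_gfun. Qed.

Lemma N2_rdiag_pair (d d' e e' : 'I_m -> R) U V :
  U *m U ^t* = 1%:M -> V *m V ^t* = 1%:M ->
  N ((U ^t* *m rdiag C d *m U) *m (V ^t* *m rdiag C e *m V) -
     (U ^t* *m rdiag C d' *m U) *m (V ^t* *m rdiag C e' *m V)) ^+ 2 =
  \sum_i \sum_j (d i * e j - d' i * e' j) ^+ 2 *
    (re ((U *m V ^t*) i j) ^+ 2 + im ((U *m V ^t*) i j) ^+ 2).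
Proof.
move=> UU VV.
have key d1 e1 : U *m ((U ^t* *m rdiag C d1 *m U) *m (V ^t* *m rdiag C e1 *m V)) *m V ^t* =
    rdiag C d1 *m (U *m V ^t*) *m rdiag C e1.
  by rewrite -!mulmxA VV mulmx1 !mulmxA UU mul1mx.
have VV' : V ^t* *m V ^t* ^t* = 1%:M by rewrite trmxCK unitaryC.
set X := _ - _; rewrite -(N_unitaryl X UU) -(N_unitaryr (U *m X) VV').
rewrite /X mulmxBr mulmxBl !key N2_sum.
apply: eq_bigr => i _; apply: eq_bigr => j _; set W := U *m V ^t*.
have E d1 e1 : (rdiag C d1 *m W *m rdiag C e1) i j = (d1 i * e1 j)%:C * W i j.
  by rewrite mul_mx_diag mxE mul_diag_mx !mxE rmorphM /=; ring.
have -> (A B : M) : (A - B) i j = A i j - B i j by rewrite !mxE.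
rewrite !E -mulrBl -rmorphB.
by rewrite reZ imZ; ring.
Qed.

(* Both matrices become diagonal when the rows are expressed in the eigenbasis
   of [H] and the columns in that of [K]. *)
Lemma N2_gfun_pair (f f' g g' : R -> R) H K :
  let W := spectralmx H *m (spectralmx K) ^t* in
  N (gfun f H *m gfun g K - gfun f' H *m gfun g' K) ^+ 2 =
  \sum_i \sum_j (f (spec H i) * g (spec K j) - f' (spec H i) * g' (spec K j)) ^+ 2 *
    (re (W i j) ^+ 2 + im (W i j) ^+ 2).
Proof.
by move=> W; rewrite !gfunE; apply: N2_rdiag_pair; exact: spec_unitary.
Qed.

Lemma N_gfun_lipschitz f H K (L : R) : herm H -> herm K -> 0 <= L ->
  (forall i j, `|f (spec H i) - f (spec K j)| <= L * `|spec H i - spec K j|) ->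
  N (gfun f H - gfun f K) <= L * N (H - K).
Proof.
move=> hH hK L0 fL.
(* Inserting 1 as a constant function of the other matrix brings both differences to the form f(H)
   g(K) - f'(H) g'(K), with the same weights |w_ij|^2. *)
have mulone A : A = A *m gfun (fun=> 1) K by rewrite gfun_const rmorph1 mulmx1.
have onemul A : A = gfun (fun=> 1) H *m A by rewrite gfun_const rmorph1 mul1mx.
rewrite -ler_sqr ?nnegrE ?mulr_ge0 ?N_ge0 // exprMn.
rewrite [gfun f H]mulone [gfun f K]onemul N2_gfun_pair.
rewrite -[X in N (X - _)](gfun_id hH) -[X in N (_ - X)](gfun_id hK).
rewrite [gfun id H]mulone [gfun id K]onemul N2_gfun_pair mulr_sumr.
apply: ler_sum => i _; rewrite mulr_sumr; apply: ler_sum => j _.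
rewrite !mulr1 !mul1r mulrA ler_wpM2r ?addr_ge0 ?sqr_ge0 // -exprMn.
rewrite -[leLHS]real_normK ?num_real // -[leRHS]real_normK ?num_real //.
by rewrite ler_sqr ?nnegrE // normrM (ger0_norm L0).
Qed.

Lemma spec_gram_ge0 A i : 0 <= spec (A *m A ^t*) i.
Proof.
have hA : herm (A *m A ^t*) by rewrite /herm adjM trmxCK.
have E : (spectralmx (A *m A ^t*) *m A) *m (spectralmx (A *m A ^t*) *m A) ^t* =
    rdiag C (spec (A *m A ^t*)).
  rewrite adjM !mulmxA -(mulmxA _ A) spectral_mul //.
  by rewrite -mulmxA spec_unitary mulmx1.
have /(congr1 (fun X : M => re (X i i))) := E.
rewrite [in RHS]mxE [in RHS]mxE eqxx mulr1n re_rc => <-.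
rewrite mxE re_sum; apply: sumr_ge0 => k _.
rewrite !mxE re_mulJ.
by rewrite -!expr2 addr_ge0 ?sqr_ge0.
Qed.

(** The eigenvalues of A A^* are nonnegative, so the sum of their squares is at most the square of
    their sum, and that sum is the trace |A|^2. *)
Lemma N_gram A : N (A *m A ^t*) <= N A ^+ 2.
Proof.
have hA : herm (A *m A ^t*) by rewrite /herm adjM trmxCK.
have -> : N A ^+ 2 = \sum_i spec (A *m A ^t*) i.
  by rewrite -(tr_gfun id) gfun_id // N2.
have s0 := @spec_gram_ge0 A.
rewrite -ler_sqr ?nnegrE ?N_ge0 ?sumr_ge0 // -[X in N X](gfun_id hA) N2_gfun.
rewrite [leRHS]expr2 mulr_suml; apply: ler_sum => i _; rewrite expr2 ler_wpM2l //.
by rewrite (bigD1 i) //= lerDl sumr_ge0.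
Qed.

(** By cyclicity of the trace |AB|^2 is the inner product of B B^* and A^* A; Cauchy-Schwarz and
    [N_gram] finish. *)
Lemma N_mul A B : N (A *m B) <= N A * N B.
Proof.
rewrite -ler_sqr ?nnegrE ?mulr_ge0 ?N_ge0 //.
have -> : N (A *m B) ^+ 2 = ip (B *m B ^t*) (A ^t* *m A ^t* ^t*).
  rewrite N2 /ip adjM trmxCK adjM trmxCK !mulmxA.
  by rewrite [in RHS]mxtrace_mulC !mulmxA.
apply: le_trans (N_Cauchy_Schwarz _ _) _; rewrite exprMn mulrC -(N_adj A).
by apply: ler_pM; rewrite ?N_ge0 // N_gram.
Qed.

Definition gposdef A :=
  A ^t* = A /\ (forall v : 'rV[C]_m, v != 0 -> 0 < (v *m A *m v ^t*) 0 0).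

Lemma gposdef1 : gposdef 1%:M.
Proof.
split=> [|v v0]; first exact: adj1.
by rewrite mulmx1 -dotmxE; exact: dotmx_is_dotmx.
Qed.

Lemma gposdef_herm A : gposdef A -> herm A.
Proof. by case. Qed.

(** The quadratic form of A at the i-th row of its spectral matrix equals the i-th eigenvalue. *)
Lemma gposdef_spec A i : gposdef A -> 0 < spec A i.
Proof.
case=> hA /(_ (row i (spectralmx A))).
have -> : row i (spectralmx A) != 0.
  apply/eqP => r0; have /matrixP/(_ i i) := spec_unitary A.
  rewrite !mxE eqxx big1 => [/eqP|j _]; first by rewrite eq_sym oner_eq0.
  by have /rowP/(_ j) := r0; rewrite !mxE => ->; rewrite mul0r.
move=> /(_ isT); rewrite -row_mul spectral_mul // row_mul -mulmxA.
have -> : spectralmx A *m (row i (spectralmx A)) ^t* = col i 1%:M.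
  rewrite -(spec_unitary A); apply/colP => k; rewrite !mxE.
  by apply: eq_bigr => j _; rewrite !mxE.
rewrite mxE (bigD1 i) //= big1 => [|j /negPf ji]; last first.
  by rewrite !mxE ji mulr0.
by rewrite !mxE eqxx !mulr1 mulr1n addr0 rc_gt0.
Qed.

Lemma gposdef_gfun f A : (forall i, 0 < f (spec A i)) -> gposdef (gfun f A).
Proof.
move=> f0; split=> [|v v0]; first exact: adj_gfun.
pose w := v *m (spectralmx A) ^t*.
have w0 : w != 0.
  apply: contra v0 => /eqP w0.
  by rewrite -[v]mulmx1 -(spec_unitaryC A) mulmxA -/w w0 mul0mx.
have -> : v *m gfun f A *m v ^t* = w *m rdiag C (fun i => f (spec A i)) *m w ^t*.
  by rewrite gfunE /w trmx_mul map_mxM trmxCK !mulmxA.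
have /rV0Pn[i wi] := w0; clearbody w.
rewrite mul_mx_diag mxE (bigD1 i) //= ltr_wpDr //.
  apply: sumr_ge0 => j _; rewrite !mxE mulrAC mulr_ge0 ?mul_conjC_ge0 //.
  by rewrite rc_ge0 ltW.
by rewrite !mxE mulrAC mulr_gt0 ?mul_conjC_gt0 // rc_gt0.
Qed.

Lemma gposdef_conj A V : gposdef A -> V \in unitmx -> gposdef (V *m A *m V ^t*).
Proof.
move=> [hA pA] Vu; split=> [|v v0]; first exact: herm_conj.
have := pA (v *m V); rewrite trmx_mul map_mxM !mulmxA; apply.
by apply: contra v0 => /eqP vV; rewrite -[v](mulmxK Vu) vV mul0mx.
Qed.

Definition glog A : M := gfun (@ln R) A.

Definition gpow A (t : R) : M := gfun (fun x => expR (t * ln x)) A.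

Definition gexp A : M := gfun (@expR R) A.

Lemma herm_gexp A : herm (gexp A). Proof. exact: adj_gfun. Qed.

Lemma herm_glog A : herm (glog A). Proof. exact: adj_gfun. Qed.

#[local] Hint Resolve herm_gexp herm_glog herm0 herm1 : core.

Lemma gposdef_gexp A : gposdef (gexp A).
Proof. by apply: gposdef_gfun => i; exact: expR_gt0. Qed.

Lemma gexp_log A : gposdef A -> gexp (glog A) = A.
Proof.
move=> pA; rewrite /gexp /glog gfun_comp -[RHS](gfun_id (gposdef_herm pA)).
by apply: eq_gfun => i; rewrite lnK // posrE gposdef_spec.
Qed.

Lemma glog_exp H : herm H -> glog (gexp H) = H.
Proof.
move=> hH; rewrite /gexp /glog gfun_comp -[RHS](gfun_id hH).
by apply: eq_gfun => i; rewrite expRK.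
Qed.

Lemma gexpZ (s : R) H : herm H ->
  gexp (s%:C *: H) = gfun (fun x => expR (s * x)) H.
Proof. by move=> hH; rewrite /gexp -gfunZ // gfun_comp. Qed.

Lemma gexpD (s t : R) H : herm H ->
  gexp (s%:C *: H) *m gexp (t%:C *: H) = gexp ((s + t)%:C *: H).
Proof.
move=> hH; rewrite !gexpZ // gfunM; apply: eq_gfun => i.
by rewrite -expRD mulrDl.
Qed.

Lemma gexp0 : gexp 0 = 1%:M.
Proof.
have := gexpZ 0 (herm0 C m); rewrite rmorph0 scale0r => ->.
have := gfun_const (1 : R) (0 : M); rewrite rmorph1 => <-.
by apply: eq_gfun => i; rewrite mul0r expR0.
Qed.

Lemma gexpNK H : herm H -> gexp H *m gexp (- H) = 1%:M.
Proof.
move=> hH; have := gexpD 1 (- 1) hH; rewrite subrr rmorph0 rmorphN rmorph1 scaleNr.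
by rewrite scale1r scale0r gexp0.
Qed.

Lemma gpowE A (t : R) : gposdef A -> gpow A t = gexp (t%:C *: glog A).
Proof. by move=> pA; rewrite gexpZ // /glog gfun_comp. Qed.

Lemma glog_conj H U : herm H -> U *m U ^t* = 1%:M ->
  glog (U *m H *m U ^t*) = U *m glog H *m U ^t*.
Proof. exact: gfun_conj. Qed.

Definition ghsnorm A : R := Num.sqrt (re (\tr (A *m A))).

Lemma hsnormE H : herm H -> ghsnorm H = N H.
Proof. by move=> hH; rewrite /ghsnorm /N /ip hH. Qed.

(** * The Riemannian distance *)

Definition pdm A B : R := ghsnorm (glog (gpow A (- 2^-1) *m B *m gpow A (- 2^-1))).

(** With Q = A^{-1/2}, the identity Q A Q = 1 says that U = Q V is unitary, and the matrix under the
    logarithm is U e^H U^*. The distance from A can therefore be computed with any factor V of A in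
    place of the square root. *)
Lemma pdm_conj V H : V \in unitmx -> herm H ->
  pdm (V *m V ^t*) (V *m gexp H *m V ^t*) = N H.
Proof.
move=> Vu hH; set A := V *m V ^t*.
have pA : gposdef A.
  rewrite /A -{1}[V]mulmx1; apply: gposdef_conj => //.
  exact: gposdef1.
rewrite /pdm; set Q := gpow A _.
have hQ : Q ^t* = Q by rewrite /Q; apply: adj_gfun.
have QAQ : Q *m A *m Q = 1%:M.
  rewrite /Q gpowE // -[X in _ *m X *m _](gexp_log pA).
  have -> : glog A = 1%:C *: glog A by rewrite rmorph1 scale1r.
  rewrite scalerA -rmorphM mulr1 !gexpD // -[RHS]gexp0; congr gexp.
  by rewrite (_ : _ + _ = 0) ?rmorph0 ?scale0r //; lra.
clearbody Q; pose U := Q *m V.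
have UU : U *m U ^t* = 1%:M.
  by rewrite /U adjM hQ !mulmxA -(mulmxA Q).
have -> : Q *m (V *m gexp H *m V ^t*) *m Q = U *m gexp H *m U ^t*.
  by rewrite /U adjM hQ !mulmxA.
rewrite glog_conj // glog_exp // hsnormE; last exact: herm_conj.
rewrite N_unitaryr ?N_unitaryl // trmxCK; exact: unitaryC.
Qed.

End PositiveMatrices.

(** * Exponential charts and nonpositive curvature *)

Section Geometry.
Local Open Scope sesquilinear_scope.
Variables (R : realType) (C : complexification R) (m : nat).
Local Notation M := 'M[C]_m.
Local Notation "x %:C" := (rc C x) : ring_scope.
Implicit Types (A B H K U V W : M) (d e : 'I_m -> R) (f g : R -> R).
#[local] Hint Resolve herm_gexp herm_glog herm0 herm1 : core.

Definition cong V H : M := V *m gexp H *m V ^t*.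

Lemma gposdef_cong V H : V \in unitmx -> gposdef (cong V H).
Proof. by move=> Vu; apply: gposdef_conj => //; exact: gposdef_gexp. Qed.

Lemma cong0 V : cong V 0 = V *m V ^t*.
Proof. by rewrite /cong gexp0 mulmx1. Qed.

Lemma cong_mul W V H : cong (W *m V) H = W *m cong V H *m W ^t*.
Proof. by rewrite /cong adjM !mulmxA. Qed.

Lemma cong_id H : cong 1%:M H = gexp H.
Proof. by rewrite /cong adj1 mulmx1 mul1mx. Qed.

Lemma cong_surj V A : V \in unitmx -> gposdef A ->
  exists2 H, herm H & A = cong V H.
Proof.
move=> Vu pA; exists (glog (invmx V *m A *m (invmx V) ^t*)) => //.
rewrite /cong gexp_log; last by apply: gposdef_conj; rewrite ?unitmx_inv.
rewrite !mulmxA mulmxV // mul1mx -mulmxA adj_inv // mulVmx ?mulmx1 //.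
exact: adj_unit.
Qed.

Lemma gexp_half (s : R) H : herm H ->
  gexp ((s / 2)%:C *: H) *m (gexp ((s / 2)%:C *: H)) ^t* = gexp (s%:C *: H).
Proof.
by move=> hH; rewrite (herm_gexp _) gexpD // -splitr.
Qed.

Lemma gexp_unit H : herm H -> gexp H \in unitmx.
Proof. by move=> hH; have /mulmx1_unit[] := gexpNK hH. Qed.

Lemma gposdef_factor A : gposdef A -> exists2 V, V \in unitmx & A = cong V 0.
Proof.
move=> pA; exists (gexp ((1 / 2)%:C *: glog A)).
  by apply: gexp_unit; apply: hermZ.
by rewrite cong0 gexp_half // rmorph1 scale1r gexp_log.
Qed.

Lemma cong_shift V (s t : R) H : herm H ->
  cong V (t%:C *: H) = cong (V *m gexp ((s / 2)%:C *: H)) ((t - s)%:C *: H).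
Proof.
move=> hH; rewrite cong_mul /cong (herm_gexp _) !gexpD //.
by have -> : s / 2 + (t - s) + s / 2 = t by lra.
Qed.

Lemma pdm_cong V H : V \in unitmx -> herm H -> pdm (cong V 0) (cong V H) = N H.
Proof. by move=> Vu hH; rewrite cong0 pdm_conj. Qed.

Lemma pdm_geodesic V (s t : R) H : V \in unitmx -> herm H ->
  pdm (cong V (s%:C *: H)) (cong V (t%:C *: H)) = `|t - s| * N H.
Proof.
move=> Vu hH; rewrite (cong_shift V s s) // (cong_shift V s t) //.
rewrite subrr rmorph0 scale0r pdm_cong ?NZ //; last exact: hermZ.
by rewrite unitmx_mul Vu gexp_unit //; exact: hermZ.
Qed.

Lemma pdm_ge0 A B : 0 <= pdm A B.
Proof. exact: sqrtr_ge0. Qed.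

Lemma pdm_sym A B : gposdef A -> gposdef B -> pdm A B = pdm B A.
Proof.
move=> /gposdef_factor[V Vu ->] /(cong_surj Vu)[H hH ->].
have := pdm_geodesic 0 1 Vu hH; have := pdm_geodesic 1 0 Vu hH.
rewrite rmorph0 rmorph1 scale0r scale1r => -> ->.
by rewrite subr0 sub0r normrN.
Qed.

Lemma pdm_congruence W A B : W \in unitmx -> gposdef A -> gposdef B ->
  pdm (W *m A *m W ^t*) (W *m B *m W ^t*) = pdm A B.
Proof.
move=> Wu /gposdef_factor[V Vu ->] /(cong_surj Vu)[H hH ->].
by rewrite -!cong_mul !pdm_cong // unitmx_mul Wu.
Qed.

Lemma re_tr1 : re (\tr (1%:M : M)) = m%:R.
Proof. by rewrite mxtrace1 -(rmorph_nat (rc C)) re_rc. Qed.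

Lemma N2B A B : N (A - B) ^+ 2 = N A ^+ 2 + N B ^+ 2 - 2 * ip A B.
Proof. by rewrite !N2 !(ipDl, ipDr, ipNl, ipNr) [ip B A]ipC; ring. Qed.

Lemma N2D A B : N (A + B) ^+ 2 = N A ^+ 2 + N B ^+ 2 + 2 * ip A B.
Proof. by rewrite !N2 !(ipDl, ipDr) [ip B A]ipC; ring. Qed.

(* In the eigenbases of [U] and [V] this is [x^2 <= 4 sinh(x/2)^2] entrywise. *)
Lemma N2_sub_le_trace U V : herm U -> herm V ->
  N (U - V) ^+ 2 <= re (\tr (gexp U *m gexp (- V))) +
                   re (\tr (gexp (- U) *m gexp V)) - 2 * m%:R.
Proof.
move=> hU hV; pose E (s : R) W := gfun (fun x => expR (s * x)) W.
have EE s t W : E s W *m E t W = E (s + t) W.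
  by rewrite /E gfunM; apply: eq_gfun => i; rewrite -expRD mulrDl.
have E1 W : herm W -> E 1 W = gexp W.
  by move=> hW; rewrite /E /gexp; apply: eq_gfun => i; rewrite mul1r.
have EN1 W : herm W -> E (-1) W = gexp (- W).
  by move=> hW; rewrite /E -gexpZ // rmorphN rmorph1 scaleN1r.
have E0 W : herm W -> E 0 W = 1%:M.
  by move=> hW; rewrite /E -gexpZ // rmorph0 scale0r gexp0.
have hE s W : (E s W) ^t* = E s W by exact: adj_gfun.
have trE s t : N (E s U *m E t V) ^+ 2 = re (\tr (E (s + s) U *m E (t + t) V)).
  rewrite N2 /ip adjM !hE mulmxA -(mulmxA _ _ (E t V)) EE.
  by rewrite mxtrace_mulC mulmxA EE.
have half : 2^-1 + 2^-1 = 1 :> R by lra.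
have halfN : - 2^-1 - 2^-1 = - 1 :> R by lra.
have main : N (U - V) ^+ 2 <=
    N (E 2^-1 U *m E (- 2^-1) V - E (- 2^-1) U *m E 2^-1 V) ^+ 2.
  rewrite -[X in X - _](gfun_id hU) -[X in _ - X](gfun_id hV).
  have -> : gfun id U = gfun id U *m gfun (fun=> 1) V.
    by rewrite gfun_const rmorph1 mulmx1.
  have -> : gfun id V = gfun (fun=> 1) U *m gfun id V.
    by rewrite gfun_const rmorph1 mul1mx.
  have sumL := N2_gfun_pair id (fun=> 1) (fun=> 1) id U V.
  have sumR := N2_gfun_pair (fun x => expR (2^-1 * x)) (fun x => expR (- 2^-1 * x))
    (fun x => expR (- 2^-1 * x)) (fun x => expR (2^-1 * x)) U V.
  rewrite [leLHS]sumL [leRHS]sumR {sumL sumR}.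
  apply: ler_sum => i _; apply: ler_sum => j _.
  rewrite ler_wpM2r ?addr_ge0 ?sqr_ge0 // mulr1 mul1r -!expRD.
  have := sqr_le_cosh (spec U i - spec V j).
  by congr (_ <= (expR _ - expR _) ^+ 2); lra.
clearbody E.
(* In the cross term the half powers cancel, leaving tr 1 = m; this is the origin of - 2m. *)
have ipE : ip (E 2^-1 U *m E (- 2^-1) V) (E (- 2^-1) U *m E 2^-1 V) = m%:R.
  rewrite /ip adjM !hE mulmxA -(mulmxA _ _ (E 2^-1 V)) EE addNr E0 // mulmx1.
  by rewrite EE subrr E0 // re_tr1.
apply: le_trans main _; rewrite N2B ipE (trE 2^-1 (- 2^-1)) (trE (- 2^-1) 2^-1) half halfN.
rewrite (E1 _ hU) (E1 _ hV) (EN1 _ hU) (EN1 _ hV); lra.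
Qed.

Lemma N2_spec H : herm H -> N H ^+ 2 = \sum_i spec H i ^+ 2.
Proof. by move=> hH; rewrite -[X in N X](gfun_id hH) N2_gfun. Qed.

Lemma spec_le_N H i : herm H -> `|spec H i| <= N H.
Proof.
move=> hH; rewrite -ler_sqr ?nnegrE ?N_ge0 // real_normK ?num_real //.
rewrite (N2_spec hH) (bigD1 i) //= lerDl.
by apply: sumr_ge0 => j _; exact: sqr_ge0.
Qed.

(** For two points A, B of one geodesic, A B^{-1} = V e^{(s-t)H} V^{-1}. The two traces that bound
    the logarithms are thus sums of e^x and e^{-x} over x = (s - t) h_i, with h_i the eigenvalues of
    H. *)
Lemma N_log_geodesic V (s t : R) H : V \in unitmx -> herm H ->
  N (glog (cong V (s%:C *: H)) - glog (cong V (t%:C *: H))) ^+ 2 <=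
  ((s - t) * N H) ^+ 2 * expR (`|s - t| * N H).
Proof.
move=> Vu hH; set A := cong V _; set B := cong V _.
have pA : gposdef A by exact: gposdef_cong.
have pB : gposdef B by exact: gposdef_cong.
apply: le_trans (N2_sub_le_trace _ _) _ => //.
have inv (r : R) : gexp (- glog (cong V (r%:C *: H))) =
    (invmx V) ^t* *m gexp ((- r)%:C *: H) *m invmx V.
  have pX : gposdef (cong V (r%:C *: H)) by exact: gposdef_cong.
  have := gexpNK (herm_glog (cong V (r%:C *: H))); rewrite gexp_log //.
  set X := cong V _; set Y := gexp _; set Z := _ *m invmx V => XY.
  have ZX : Z *m X = 1%:M.
    rewrite /Z /X /cong !mulmxA mulmxKV // -(mulmxA (_ ^t*)) gexpD // addNr.
    rewrite rmorph0 scale0r gexp0 mulmx1 adj_inv // mulVmx //.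
    exact: adj_unit.
  by rewrite -[Y]mul1mx -ZX -mulmxA XY mulmx1.
have tr (r u : R) : re (\tr (cong V (r%:C *: H) *m gexp (- glog (cong V (u%:C *: H))))) =
    \sum_i expR ((r - u) * spec H i).
  rewrite inv /cong mxtrace_mulC !mulmxA mulmxKV //.
  rewrite mxtrace_mulC mulmxA mulmxA adj_inv // mulmxV ?adj_unit // mul1mx.
  by rewrite gexpD // gexpZ // tr_gfun addrC.
have trAB := tr s t; have trBA := tr t s; rewrite -/A -/B in trAB trBA.
clearbody A B.
rewrite (gexp_log pA) (gexp_log pB) [\tr (gexp (- glog A) *m B)]mxtrace_mulC.
rewrite trAB trBA.
have -> : 2 * m%:R = \sum_(i < m) (2 : R).
  by rewrite sumr_const card_ord mulr_natr.
rewrite -sumrN -!big_split /= exprMn mulrAC (N2_spec hH).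
rewrite mulr_sumr; apply: ler_sum => i _.
set x := (s - t) * spec H i.
have -> : expR x + expR ((t - s) * spec H i) - 2 =
    (expR (x / 2) - expR (- (x / 2))) ^+ 2.
  have -> : (t - s) * spec H i = - x by rewrite /x; ring.
  have e1 : expR (x / 2) ^+ 2 = expR x by rewrite -expRM_natl; congr expR; lra.
  have e2 : expR (- (x / 2)) ^+ 2 = expR (- x) by rewrite -expRM_natl; congr expR; lra.
  have e3 : expR (x / 2) * expR (- (x / 2)) = 1 by rewrite -expRD subrr expR0.
  by rewrite sqrrB e1 e2 e3; lra.
apply: le_trans (cosh_le_sqr x) _.
rewrite /x exprMn [leRHS]mulrAC ler_wpM2l ?(mulr_ge0 (sqr_ge0 _) (sqr_ge0 _)) //.
by rewrite ler_expR normrM ler_wpM2l // spec_le_N.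
Qed.

Lemma le_add_harmonic (x y c : R) : (forall n, x <= y + c / n.+1%:R) -> x <= y.
Proof.
move=> h; apply/ler_addgt0Pr => e e0.
have [n nE] : exists n : nat, `|c| / e < n.+1%:R.
  exists (Num.truncn (`|c| / e)); exact: truncnS_gt.
apply: le_trans (h n) _; rewrite lerD2l ler_pdivrMr //.
by rewrite mulrC -ler_pdivrMr //; apply: le_trans (ltW nE); rewrite ler_pM2r ?invr_gt0 ?ler_norm.
Qed.

(* Exponential metric increasing property: subdivide the geodesic from [A] to [B]
   and let the mesh tend to 0. *)
Lemma N_log_le_pdm A B : gposdef A -> gposdef B -> N (glog A - glog B) <= pdm A B.
Proof.
move=> /gposdef_factor[V Vu ->] /(cong_surj Vu)[H hH ->].
rewrite pdm_cong //; set a := N H.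
have a0 : 0 <= a by exact: N_ge0.
pose L (s : R) := glog (cong V (s%:C *: H)).
(* The excess over the length z = |s - t| a is quadratic in z, so n + 1 pieces of length a / (n + 1)
   add up to a + O(1/n). *)
have step s t : N (L s - L t) <= `|s - t| * a * (1 + `|s - t| * a * expR (`|s - t| * a)).
  set z := `|s - t| * a; have z0 : 0 <= z by rewrite mulr_ge0.
  have ez1 : expR (z / 2) <= 1 + z * expR z.
    have h1 : expR (z / 2) <= expR z by rewrite ler_expR; lra.
    have h2 := expR_ge1Dx (- z).
    have h3 : expR z * expR (- z) = 1 by rewrite -expRD subrr expR0.
    have := expR_gt0 z; nra.
  apply: (@le_trans _ _ (z * expR (z / 2))); last exact: ler_wpM2l.
  rewrite -ler_sqr ?nnegrE ?N_ge0 ?mulr_ge0 ?expR_ge0 // exprMn -expRM_natl.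
  rewrite (_ : 2 * (z / 2) = z); last lra.
  have -> : z ^+ 2 = ((s - t) * a) ^+ 2.
    by rewrite /z !exprMn real_normK ?num_real.
  exact: N_log_geodesic.
apply: (@le_add_harmonic _ _ (a * a * expR a)) => n.
have chain k : N (L 0 - L (k%:R / n.+1%:R)) <=
    k%:R * (n.+1%:R^-1 * a * (1 + n.+1%:R^-1 * a * expR a)).
  elim: k => [|k IH]; first by rewrite !mul0r subrr N0.
  rewrite -(subrKA (L (k%:R / n.+1%:R))) -[k.+1%:R]natr1 [leRHS]mulrDl mul1r.
  apply: le_trans (N_triangle _ _) _; apply: lerD => //.
  apply: le_trans (step _ _) _.
  have -> : `|k%:R / n.+1%:R - (k%:R + 1) / n.+1%:R| = n.+1%:R^-1 :> R.
    by rewrite -mulrBl opprD addNKr mulN1r normrN ger0_norm ?invr_ge0.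
  rewrite ler_wpM2l ?mulr_ge0 ?invr_ge0 // lerD2l ler_wpM2l ?mulr_ge0 ?invr_ge0 //.
  by rewrite ler_expR ler_piMl // invf_le1 ?ler1n.
have := chain n.+1; rewrite divff ?pnatr_eq0 // /L rmorph0 scale0r rmorph1 scale1r.
move=> h; apply: le_trans h _.
rewrite le_eqVlt; apply/orP; left; apply/eqP; field.
by rewrite ?nat1r ?natr1 pnatr_eq0.
Qed.

(** Congruence by V is an isometry, so this is the exponential metric increasing property between
    e^K and e^H. Every curvature inequality below uses it in this form. *)
Lemma N_sub_le_pdm V K H : V \in unitmx -> herm K -> herm H ->
  N (K - H) <= pdm (cong V K) (cong V H).
Proof.
move=> Vu hK hH.
have -> : pdm (cong V K) (cong V H) = pdm (gexp K) (gexp H).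
  by rewrite -[RHS](pdm_congruence Vu) //; exact: gposdef_gexp.
by rewrite -[X in N (X - _)](glog_exp hK) -[X in N (_ - X)](glog_exp hH)
  N_log_le_pdm //; exact: gposdef_gexp.
Qed.

Lemma pdm_triangle A B K : gposdef A -> gposdef B -> gposdef K ->
  pdm A B <= pdm A K + pdm K B.
Proof.
move=> /gposdef_factor[V Vu ->] /(cong_surj Vu)[H hH ->] /(cong_surj Vu)[G hG ->].
rewrite !pdm_cong //; have := N_sub_le_pdm Vu hG hH.
have := N_triangle G (H - G); rewrite addrC subrK -[H - G]opprB NN; lra.
Qed.

Lemma pdm_midpoint V H A : V \in unitmx -> herm H -> gposdef A ->
  2 * pdm A (cong V 0) ^+ 2 + pdm (cong V H) (cong V (- H)) ^+ 2 / 2 <=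
  pdm A (cong V H) ^+ 2 + pdm A (cong V (- H)) ^+ 2.
Proof.
move=> Vu hH /(cong_surj Vu)[K hK ->].
have -> : pdm (cong V H) (cong V (- H)) = 2 * N H.
  have := pdm_geodesic 1 (- 1) Vu hH.
  rewrite rmorphN rmorph1 scale1r scaleN1r => ->; congr (_ * _).
  by rewrite ler0_norm; lra.
rewrite [pdm (cong V K) (cong V 0)]pdm_sym; try exact: gposdef_cong.
rewrite pdm_cong //.
have le2 X Y : 0 <= X -> X <= Y -> X ^+ 2 <= Y ^+ 2 :> R.
  by move=> X0 XY; rewrite ler_sqr ?nnegrE ?(le_trans X0).
have h1 := le2 _ _ (N_ge0 _) (N_sub_le_pdm Vu hK hH).
have h2 := le2 _ _ (N_ge0 _) (N_sub_le_pdm Vu hK (hermN hH)).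
have h3 := N2B K H; have h4 := N2D K H; rewrite opprK in h2.
move: h1 h2 h3 h4.
move: (pdm (cong V K) (cong V H)) (pdm (cong V K) (cong V (- H))).
move: (N (K - H)) (N (K + H)) (N K) (N H) (ip K H) => a b c e f p q; lra.
Qed.

End Geometry.

(** * First order expansions *)

Section FirstOrder.
Local Open Scope sesquilinear_scope.
Variables (R : realType) (C : complexification R) (m : nat).
Local Notation M := 'M[C]_m.
Local Notation "x %:C" := (rc C x) : ring_scope.
Implicit Types (A B H K P U V W : M) (d e : 'I_m -> R) (f g : R -> R).
#[local] Hint Resolve herm_gexp herm_glog herm0 herm1 : core.

Lemma N_gfun_le f H (c : R) : herm H -> 0 <= c ->
  (forall i, `|f (spec H i)| <= c * `|spec H i|) -> N (gfun f H) <= c * N H.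
Proof.
move=> hH c0 fc; rewrite -ler_sqr ?nnegrE ?mulr_ge0 ?N_ge0 // exprMn.
rewrite N2_gfun (N2_spec hH) mulr_sumr; apply: ler_sum => i _.
rewrite -exprMn -[leLHS]real_normK ?num_real // -[leRHS]real_normK ?num_real //.
by rewrite ler_sqr ?nnegrE // normrM (ger0_norm c0).
Qed.

Lemma sub1_gfun P : herm P -> P - 1%:M = gfun (fun x : R => x - 1) P.
Proof.
move=> hP; rewrite -(gfunD id (fun=> -1)) gfun_id // gfun_const.
by rewrite rmorphN (rmorph1 (rc C)) raddfN.
Qed.

Lemma spec_sub1 P i : herm P -> `|spec P i - 1| <= N (P - 1%:M).
Proof.
move=> hP; rewrite -ler_sqr ?nnegrE ?N_ge0 // real_normK ?num_real //.
rewrite sub1_gfun // N2_gfun (bigD1 i) //= lerDl.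
by apply: sumr_ge0 => j _; exact: sqr_ge0.
Qed.

Lemma N_gfun_le1 f P (c : R) : herm P -> 0 <= c ->
  (forall i, `|f (spec P i)| <= c * `|spec P i - 1|) ->
  N (gfun f P) <= c * N (P - 1%:M).
Proof.
move=> hP c0 fc; rewrite -ler_sqr ?nnegrE ?mulr_ge0 ?N_ge0 // exprMn.
rewrite [leLHS]N2_gfun sub1_gfun // [X in _ * X]N2_gfun mulr_sumr; apply: ler_sum => i _.
rewrite -exprMn -[leLHS]real_normK ?num_real // -[leRHS]real_normK ?num_real //.
by rewrite ler_sqr ?nnegrE // normrM (ger0_norm c0).
Qed.

Lemma N_log_near1 P : herm P -> N (P - 1%:M) <= 2^-1 ->
  N (glog P) <= 2 * N (P - 1%:M).
Proof.
move=> hP P1; apply: N_gfun_le1 => // i.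
by apply: ln_taylor0; apply: le_trans (spec_sub1 i hP) P1.
Qed.

Lemma N_log_taylor P : herm P -> N (P - 1%:M) <= 2^-1 ->
  N (glog P - (P - 1%:M)) <= 2 * N (P - 1%:M) ^+ 2.
Proof.
move=> hP P1; have -> : glog P - (P - 1%:M) = gfun (fun x : R => ln x - (x - 1)) P.
  rewrite -(gfunD (@ln R) (fun x : R => - (x - 1))); congr (_ + _).
  rewrite (_ : gfun _ P = gfun (fun x : R => - 1 * (x - 1)) P); last first.
    by apply: eq_gfun => i; rewrite mulN1r.
  by rewrite -(gfunM (fun=> -1)) gfun_const sub1_gfun // mul_scalar_mx rmorphN (rmorph1 (rc C)) scaleN1r.
rewrite expr2 mulrA; apply: N_gfun_le1; rewrite ?mulr_ge0 ?N_ge0 // => i.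
have s1 := spec_sub1 i hP.
apply: le_trans (ln_taylor1 (le_trans s1 P1)) _.
by rewrite -real_normK ?num_real // expr2 mulrA ler_wpM2r // ler_wpM2l.
Qed.

Lemma N_exp_lipschitz H K (k : R) : herm H -> herm K -> N H <= k -> N K <= k ->
  N (gexp H - gexp K) <= expR k * N (H - K).
Proof.
move=> hH hK Hk Kk; apply: N_gfun_lipschitz => // [i j].
by apply: expR_lipschitz; [have := spec_le_N i hH | have := spec_le_N j hK];
  move=> /(le_trans (ler_norm _)) h; apply: le_trans h _.
Qed.

Lemma N_exp_sub1 H (k : R) : herm H -> N H <= k -> N (gexp H - 1%:M) <= expR k * N H.
Proof.
move=> hH Hk; have := N_exp_lipschitz hH (herm0 C m) Hk.
by rewrite gexp0 subr0 N0; apply; apply: le_trans Hk; exact: N_ge0.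
Qed.

Lemma N_exp_taylor H : herm H -> N (gexp H - 1%:M - H) <= N H ^+ 2 * expR (N H).
Proof.
move=> hH; have -> : gexp H - 1%:M - H = gfun (fun x : R => expR x - 1 - x) H.
  rewrite -(gfunD (fun x : R => expR x - 1) (fun x : R => - x)) -(gfunD (@expR R) (fun=> - 1)).
  rewrite gfun_const rmorphN (rmorph1 (rc C)) raddfN; congr (_ + _).
  rewrite (_ : gfun _ H = gfun ( *%R (- 1)) H); last first.
    by apply: eq_gfun => i; rewrite mulN1r.
  by rewrite gfunZ // rmorphN (rmorph1 (rc C)) scaleN1r.
rewrite expr2 mulrAC; apply: N_gfun_le => //.
  by rewrite mulr_ge0 ?N_ge0 ?expR_ge0.
move=> i; apply: le_trans (expR_taylor1 _) _.
have s := spec_le_N i hH.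
rewrite -real_normK ?num_real // expr2 -mulrA mulrC ler_wpM2r //.
by apply: ler_pM; rewrite ?expR_ge0 // ler_expR.
Qed.

Lemma pdm_near V A : V \in unitmx -> gposdef A ->
  N (invmx V) ^+ 2 * N (A - cong V 0) <= 2^-1 ->
  pdm (cong V 0) A <= 2 * N (invmx V) ^+ 2 * N (A - cong V 0).
Proof.
move=> Vu pA small; have [H hH AH] := cong_surj Vu pA.
have le : N (gexp H - 1%:M) <= N (invmx V) ^+ 2 * N (A - cong V 0).
  have -> : gexp H - 1%:M = invmx V *m (A - cong V 0) *m (invmx V) ^t*.
    rewrite AH cong0 mulmxBr mulmxBl /cong !mulmxA mulVmx // mul1mx.
    rewrite -mulmxA adj_inv // mulmxV ?adj_unit // mulmx1.
    by rewrite mul1mx mulmxV ?adj_unit.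
  apply: le_trans (N_mul _ _) _; rewrite N_adj mulrC expr2 -mulrA.
  by rewrite ler_wpM2l ?N_ge0 // N_mul.
rewrite AH pdm_cong // -AH -[X in N X <= _](glog_exp hH).
apply: le_trans (N_log_near1 _ (le_trans le small)) _ => //.
by rewrite -mulrA ler_wpM2l.
Qed.

(** The expansion F(t) = 1 + t D + O(t^2) at 0. The bound e <= 1 lets |t| be replaced by 1 when such
    expansions are multiplied. *)
Definition first_order (F : R -> M) (D : M) := exists c e : R,
  [/\ 0 <= c, 0 < e, e <= 1 &
   forall t, `|t| < e -> N (F t - 1%:M - t%:C *: D) <= c * t ^+ 2].

Lemma first_order_exp H : herm H -> first_order (fun t => gexp (t%:C *: H)) H.
Proof.
move=> hH; exists (N H ^+ 2 * expR (N H)), 1; split=> // [|t t1].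
  by rewrite mulr_ge0 ?sqr_ge0 ?expR_ge0.
apply: le_trans (N_exp_taylor (hermZ t hH)) _.
rewrite NZ exprMn real_normK ?num_real // [leRHS]mulrC [leRHS]mulrA ler_wpM2l ?(mulr_ge0 (sqr_ge0 _) (sqr_ge0 _)) //.
by rewrite ler_expR ler_piMl ?N_ge0 // ltW.
Qed.

Lemma N_scaleM (t : R) A B : N ((t%:C *: A) *m (t%:C *: B)) <= t ^+ 2 * (N A * N B).
Proof.
rewrite -scalemxAl -scalemxAr scalerA -rmorphM NZ normrM -expr2.
by rewrite real_normK ?num_real // ler_wpM2l ?sqr_ge0 // N_mul.
Qed.

Lemma first_order_bound (F : R -> M) (D : M) (c t : R) : 0 <= c -> `|t| <= 1 ->
  N (F t - 1%:M - t%:C *: D) <= c * t ^+ 2 ->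
  N (F t) <= N (1%:M : M) + N D + c.
Proof.
move=> c0 t1 h.
have -> : F t = (1%:M + t%:C *: D) + (F t - 1%:M - t%:C *: D).
  by apply/matrixP => i j; rewrite !mxE; ring.
apply: le_trans (N_triangle _ _) _; apply: lerD.
  apply: le_trans (N_triangle _ _) _; rewrite lerD2l NZ ler_piMl ?N_ge0 //.
apply: le_trans h _; rewrite -[leRHS]mulr1 ler_wpM2l //.
by rewrite -real_normK ?num_real // expr_le1.
Qed.

Lemma first_order_mul (F G : R -> M) (D E : M) :
  first_order F D -> first_order G E -> first_order (fun t => F t *m G t) (D + E).
Proof.
move=> [c [e [c0 e0 e1 hF]]] [c' [e' [c0' e0' e1' hG]]].
set b := N (1%:M : M) + N E + c'; set b' := N (1%:M : M) + N D.
have b0 : 0 <= b by rewrite !addr_ge0 ?N_ge0.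
have b0' : 0 <= b' by rewrite addr_ge0 ?N_ge0.
exists (c * b + b' * c' + N D * N E), (Order.min e e'); split.
- by rewrite !addr_ge0 ?mulr_ge0 ?N_ge0.
- by rewrite lt_min e0.
- by rewrite ge_min e1.
move=> t; rewrite lt_min => /andP[te te'].
have t1 : `|t| <= 1 by apply: le_trans (ltW te) e1.
have -> : F t *m G t - 1%:M - t%:C *: (D + E) =
  (F t - 1%:M - t%:C *: D) *m G t +
  (1%:M + t%:C *: D) *m (G t - 1%:M - t%:C *: E) +
  (t%:C *: D) *m (t%:C *: E).
  rewrite scalerDr; move: (t%:C *: D) (t%:C *: E) (F t) (G t) => X Y P Q.
  rewrite !mulmxBl mulmxDl !mulmxBr !mul1mx !mulmx1.
  apply/matrixP => i j; rewrite !mxE; ring.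
have t2 := sqr_ge0 t.
apply: le_trans (N_triangle _ _) _; rewrite [leRHS]mulrDl [X in _ <= X + _]mulrDl; apply: lerD; last first.
  by rewrite mulrC; exact: N_scaleM.
apply: le_trans (N_triangle _ _) _; apply: lerD.
  apply: le_trans (N_mul _ _) _; rewrite [leRHS]mulrAC ler_pM ?N_ge0 //.
    exact: hF.
  by apply: first_order_bound => //; exact: hG.
apply: le_trans (N_mul _ _) _; rewrite -[leRHS]mulrA ler_pM ?N_ge0 //.
  by apply: le_trans (N_triangle _ _) _; rewrite lerD2l NZ ler_piMl ?N_ge0.
exact: hG.
Qed.

Lemma first_order_log (F : R -> M) (D : M) : (forall t, herm (F t)) ->
  first_order F D -> exists c e : R, [/\ 0 <= c, 0 < e &
    forall t, `|t| < e -> N (glog (F t) - t%:C *: D) <= c * t ^+ 2].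
Proof.
move=> hFt [c [e [c0 e0 e1 hF]]].
set b := N D + c; have b0 : 0 <= b by rewrite addr_ge0 ?N_ge0.
have b1 : 0 < 2 * b + 1 by rewrite ltr_wpDl ?mulr_ge0.
have small t : `|t| < e -> N (F t - 1%:M) <= b * `|t|.
  move=> te; have t1 : `|t| <= 1 by apply: le_trans (ltW te) e1.
  rewrite -[F t - 1%:M](subrK (t%:C *: D)).
  apply: le_trans (N_triangle _ _) _; rewrite mulrDl addrC NZ mulrC lerD2l.
  apply: le_trans (hF _ te) _; rewrite ler_wpM2l // -real_normK ?num_real //.
  by rewrite expr2 ler_piMl.
exists (2 * b ^+ 2 + c), (Order.min e (2 * b + 1)^-1); split.
- by rewrite addr_ge0 // mulr_ge0 ?sqr_ge0.
- by rewrite lt_min e0 invr_gt0.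
move=> t; rewrite lt_min => /andP[te tb].
have Ft := small _ te.
have half : N (F t - 1%:M) <= 2^-1.
  apply: le_trans Ft _.
  have : `|t| * (2 * b + 1) <= 1 by rewrite -ler_pdivlMr // div1r ltW.
  have := normr_ge0 t; nra.
rewrite -[glog (F t)](subrK (F t - 1%:M)) -addrA.
apply: le_trans (N_triangle _ _) _; rewrite mulrDl; apply: lerD; last exact: hF.
apply: le_trans (N_log_taylor (hFt t) half) _; rewrite -mulrA ler_wpM2l //.
rewrite -[t ^+ 2]real_normK ?num_real // -exprMn ler_sqr ?nnegrE ?N_ge0 //.
by rewrite mulr_ge0.
Qed.

(** First-order terms add under products, whether or not the factors commute: - K/2 + H - K/2 = H -
    K. Both c and e depend on H. *)
Lemma lie_trotter H K : herm H -> herm K -> exists c e : R, [/\ 0 <= c, 0 < e &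
  forall t, `|t| < e ->
  N (glog (cong (gexp ((- t / 2)%:C *: K)) (t%:C *: H)) - t%:C *: (H - K)) <= c * t ^+ 2].
Proof.
move=> hH hK; have hK' : herm ((- 2^-1)%:C *: K) by exact: hermZ.
have KE t : gexp ((- t / 2)%:C *: K) = gexp (t%:C *: ((- 2^-1)%:C *: K)).
  by rewrite scalerA -rmorphM mulrN mulNr.
have := first_order_mul (first_order_mul (first_order_exp hK') (first_order_exp hH))
  (first_order_exp hK').
have -> : (- 2^-1)%:C *: K + H + (- 2^-1)%:C *: K = H - K.
  rewrite addrAC -scalerDl -rmorphD (_ : - 2^-1 - 2^-1 = - 1); last by lra.
  by rewrite rmorphN (rmorph1 (rc C)) scaleN1r addrC.
move=> /first_order_log [t|c [e [c0 e0 h]]].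
  by rewrite -[X in _ *m X](herm_gexp _); exact: herm_conj.
exists c, e; split; [exact: c0|exact: e0|] => t te; have := h t te.
by rewrite /cong (herm_gexp _) KE.
Qed.

(** The constant c depends on K alone: H enters through E (e^H - 1) E^*, which is linear in |H|. An
    H that varies with t and is o(t) therefore leaves the derivative at 0 unchanged. *)
Lemma cong_exp_taylor K : herm K -> exists2 c : R, 0 <= c & forall t H,
  `|t| <= 1 -> herm H -> N H <= 1 ->
  N (cong (gexp ((t / 2)%:C *: K)) H - 1%:M - t%:C *: K) <= c * (t ^+ 2 + N H).
Proof.
move=> hK; set b := N (1%:M : M) + expR (N K) * N K.
have b0 : 0 <= b by rewrite addr_ge0 ?mulr_ge0 ?N_ge0 ?expR_ge0.
exists (N K ^+ 2 * expR (N K) + b ^+ 2 * expR 1).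
  by apply: addr_ge0; apply: mulr_ge0; rewrite ?sqr_ge0 ?expR_ge0.
move=> t H t1 hH H1; set E := gexp _.
have -> : cong E H - 1%:M - t%:C *: K =
    (gexp (t%:C *: K) - 1%:M - t%:C *: K) + E *m (gexp H - 1%:M) *m E ^t*.
  rewrite mulmxBr mulmxBl mulmx1 gexp_half // -/(cong E H).
  move: (cong E H) (gexp (t%:C *: K)) => X Y.
  by apply/matrixP => i j; rewrite !mxE; ring.
have tK : N (t%:C *: K) <= N K by rewrite NZ ler_piMl ?N_ge0.
have EN : N E <= b.
  rewrite -[E](subrK 1%:M) addrC; apply: le_trans (N_triangle _ _) _; rewrite lerD2l.
  have tK2 : N ((t / 2)%:C *: K) <= N K.
    by rewrite NZ ler_piMl ?N_ge0 // normrM [`|2^-1|]ger0_norm ?invr_ge0 //; lra.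
  apply: le_trans (N_exp_sub1 (hermZ _ hK) tK2) _.
  by rewrite ler_wpM2l ?expR_ge0.
rewrite mulrDr; apply: le_trans (N_triangle _ _) _; apply: lerD.
  apply: le_trans (N_exp_taylor (hermZ _ hK)) _.
  rewrite mulrDl; apply: (@le_trans _ _ (N K ^+ 2 * expR (N K) * t ^+ 2)).
    rewrite NZ exprMn real_normK ?num_real // [leRHS]mulrC [leRHS]mulrA ler_wpM2l ?(mulr_ge0 (sqr_ge0 _) (sqr_ge0 _)) //.
    by rewrite ler_expR -NZ.
  by rewrite lerDl (mulr_ge0 (mulr_ge0 (sqr_ge0 _) (expR_ge0 _)) (sqr_ge0 _)).
apply: le_trans (N_mul _ _) _; rewrite N_adj.
have NH := N_exp_sub1 hH H1.
apply: (@le_trans _ _ (b * (expR 1 * N H) * b)).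
  rewrite ler_pM ?mulr_ge0 ?N_ge0 //; apply: le_trans (N_mul _ _) _.
  by rewrite ler_pM ?N_ge0.
have -> : b * (expR 1 * N H) * b = b ^+ 2 * expR 1 * N H by ring.
by rewrite [leRHS]mulrDl lerDr (mulr_ge0 (mulr_ge0 (sqr_ge0 _) (expR_ge0 _)) (N_ge0 _)).
Qed.

End FirstOrder.

(** * Comparison with the entrywise topology; real coordinates for Hermitian matrices *)

Section Charts.
Local Open Scope sesquilinear_scope.
Variables (R : realType) (C : complexification R) (m : nat).
Local Notation M := 'M[C]_m.
Local Notation "x %:C" := (rc C x) : ring_scope.
Implicit Types (A B G H K P X Y Z U V W : M) (d e : 'I_m -> R) (f g : R -> R).
#[local] Hint Resolve herm_gexp herm_glog herm0 herm1 : core.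

Lemma N_subC A B : N (A - B) = N (B - A).
Proof. by rewrite -NN opprB. Qed.

Lemma N_subxx A : N (A - A) = 0.
Proof. by rewrite subrr N0. Qed.

Lemma N_sub_triangle A B Z : N (A - Z) <= N (A - B) + N (B - Z).
Proof. by rewrite -(subrKA B A); exact: N_triangle. Qed.

Lemma pdm_midpoint_ex A B : gposdef A -> gposdef B ->
  exists2 Y, gposdef Y & forall Z, gposdef Z ->
    2 * pdm Z Y ^+ 2 + pdm A B ^+ 2 / 2 <= pdm Z A ^+ 2 + pdm Z B ^+ 2.
Proof.
move=> /gposdef_factor[V Vu ->] /(cong_surj Vu)[H hH ->].
(* The exponent is H/4, so that W W^* = V e^{H/2} V^* is the midpoint; the endpoints then have
   coordinates - H/2 and H/2. *)
pose W := V *m gexp ((2^-1 / 2)%:C *: H).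
have Wu : W \in unitmx by rewrite unitmx_mul Vu gexp_unit //; exact: hermZ.
exists (cong W 0); first exact: gposdef_cong.
pose G := (- 2^-1)%:C *: H; have hG : herm G by exact: hermZ.
have -> : cong V 0 = cong W G.
  by have := cong_shift V 2^-1 0 hH; rewrite rmorph0 scale0r sub0r.
have -> : cong V H = cong W (- G).
  have := cong_shift V 2^-1 1 hH; rewrite (rmorph1 (rc C)) scale1r => ->.
  rewrite (_ : 1 - 2^-1 = 2^-1); last by lra.
  by rewrite /G rmorphN scaleNr opprK.
by move=> Z pZ; exact: pdm_midpoint.
Qed.

Lemma pdmxx A : gposdef A -> pdm A A = 0.
Proof. by move=> /gposdef_factor[V Vu ->]; rewrite pdm_cong // N0. Qed.

Lemma pdm_subdivide A B n : gposdef A -> gposdef B ->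
  exists q : nat -> M, [/\ forall k, gposdef (q k), q 0%N = A, q n.+1 = B &
    forall k, pdm (q k) (q k.+1) = pdm A B / n.+1%:R].
Proof.
move=> /gposdef_factor[V Vu ->] /(cong_surj Vu)[H hH ->].
exists (fun k => cong V ((k%:R / n.+1%:R)%:C *: H)); split=> [k|||k].
- exact: gposdef_cong.
- by rewrite mul0r rmorph0 scale0r.
- by rewrite divff ?pnatr_eq0 // (rmorph1 (rc C)) scale1r.
rewrite pdm_geodesic // pdm_cong // -mulrBl -natrB // subSnn mul1r.
by rewrite ger0_norm ?invr_ge0 // mulrC.
Qed.

Lemma pdm_near_ex B : gposdef B -> exists e c : R, [/\ 0 < e, 0 <= c &
  forall A, gposdef A -> N (A - B) < e -> pdm B A <= c * N (A - B)].
Proof.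
move=> /gposdef_factor[V Vu ->]; set v := N (invmx V) ^+ 2.
have v0 : 0 <= v by exact: sqr_ge0.
exists ((2 * (v + 1))^-1), (2 * v); split.
- by rewrite invr_gt0 mulr_gt0 // ltr_wpDl.
- by rewrite mulr_ge0.
move=> A pA Ae; apply: pdm_near => //; rewrite -/v.
have : N (A - cong V 0) * (2 * (v + 1)) < 1.
  by rewrite -ltr_pdivlMr ?div1r // mulr_gt0 // ltr_wpDl.
have := N_ge0 (A - cong V 0); nra.
Qed.

(** Converse of [pdm_near_ex]: in a chart centred at the given point, A differs from it by W (e^K -
    1) W^*, where |K| is the distance. *)
Lemma pdm_near_N V H (e : R) : V \in unitmx -> 0 < e ->
  exists2 r : R, 0 < r & forall A, gposdef A -> pdm (cong V H) A < r ->
    N (A - cong V H) < e.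
Proof.
move=> Vu e0; have [W Wu ->] := gposdef_factor (gposdef_cong H Vu).
set w := N W ^+ 2 * expR 1.
have w0 : 0 <= w by rewrite mulr_ge0 ?expR_ge0 ?sqr_ge0.
exists (Order.min 1 (e / (w + 1))); first by rewrite lt_min ltr01 divr_gt0 // ltr_wpDl.
move=> A /(cong_surj Wu)[K hK ->]; rewrite pdm_cong // lt_min => /andP[K1 Ke].
have -> : cong W K - cong W 0 = W *m (gexp K - 1%:M) *m W ^t*.
  by rewrite mulmxBr mulmxBl cong0 mulmx1.
apply: (@le_lt_trans _ _ (w * N K)).
  apply: le_trans (N_mul _ _) _; rewrite N_adj.
  have -> : w * N K = N W * (expR 1 * N K) * N W by rewrite /w; ring.
  rewrite ler_pM ?N_ge0 //; apply: le_trans (N_mul _ _) _.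
  by rewrite ler_pM ?N_ge0 // N_exp_sub1 // ltW.
have : N K * (w + 1) < e by rewrite -ltr_pdivlMr // ltr_wpDl.
have := N_ge0 K; nra.
Qed.

Lemma gexp_pdm_cont H (e : R) : herm H -> 0 < e ->
  exists2 r : R, 0 < r & forall K, herm K -> N (K - H) < r ->
    pdm (gexp H) (gexp K) < e.
Proof.
move=> hH e0; have [e' [c [e0' c0 near]]] := pdm_near_ex (gposdef_gexp H).
set b := expR (N H + 1); have b0 : 0 < b by exact: expR_gt0.
exists (Order.min 1 (Order.min (e' / b) (e / (c * b + 1)))).
  by rewrite !lt_min ltr01 !divr_gt0 // ltr_wpDl ?mulr_ge0 // ltW.
move=> K hK; rewrite !lt_min => /and3P[K1 Ke' Ke].
have HK : N K <= N H + 1.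
  by rewrite -[K](subrK H) addrC; apply: le_trans (N_triangle _ _) _; rewrite lerD2l ltW.
have lip : N (gexp K - gexp H) <= b * N (K - H).
  by apply: N_exp_lipschitz => //; rewrite lerDl.
apply: le_lt_trans (near _ (gposdef_gexp K) _) _.
  by apply: le_lt_trans lip _; rewrite mulrC -ltr_pdivlMr.
apply: (@le_lt_trans _ _ (c * (b * N (K - H)))); first by rewrite ler_wpM2l.
have cb : 0 < c * b + 1 by rewrite ltr_wpDl ?mulr_ge0 // ltW.
have : N (K - H) * (c * b + 1) < e by rewrite -ltr_pdivlMr.
have := N_ge0 (K - H); nra.
Qed.

Definition ggeomean A B (t : R) : M :=
  gpow A (2^-1) *m gpow (gpow A (- 2^-1) *m B *m gpow A (- 2^-1)) t *m gpow A (2^-1).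

(** The coordinate of B in the chart [cong] centred at A with V = A^{1/2}. *)
Definition rlog A B : M := glog (gpow A (- 2^-1) *m B *m gpow A (- 2^-1)).

Lemma gpow_half A : gposdef A ->
  [/\ gpow A 2^-1 \in unitmx, (gpow A 2^-1) ^t* = gpow A 2^-1,
      invmx (gpow A 2^-1) = gpow A (- 2^-1) & A = cong (gpow A 2^-1) 0].
Proof.
move=> pA; have hV : (gpow A 2^-1) ^t* = gpow A 2^-1 by exact: adj_gfun.
have VV : gpow A (- 2^-1) *m gpow A 2^-1 = 1%:M.
  by rewrite !gpowE // gexpD // addNr rmorph0 scale0r gexp0.
have [_ Vu] := mulmx1_unit VV; split=> //.
  by rewrite -[RHS](mulmxK Vu) VV mul1mx.
rewrite cong0 hV gpowE // gexpD // (_ : 2^-1 + 2^-1 = 1); last by lra.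
by rewrite (rmorph1 (rc C)) scale1r gexp_log.
Qed.

Lemma cong_rlog A B : gposdef A -> gposdef B -> cong (gpow A 2^-1) (rlog A B) = B.
Proof.
move=> pA pB; have [Vu hV Vi _] := gpow_half pA.
have pS : gposdef (gpow A (- 2^-1) *m B *m gpow A (- 2^-1)).
  rewrite -[X in _ *m X](adj_gfun _ A) -/(gpow A _) -Vi.
  by apply: gposdef_conj; rewrite ?unitmx_inv.
rewrite /cong /rlog gexp_log // hV -Vi !mulmxA mulmxV // mul1mx.
by rewrite mulmxKV.
Qed.

Lemma ggeomeanE A B (t : R) : gposdef A -> gposdef B ->
  ggeomean A B t = cong (gpow A 2^-1) (t%:C *: rlog A B).
Proof.
move=> pA pB; have [Vu hV Vi _] := gpow_half pA.
have pS : gposdef (gpow A (- 2^-1) *m B *m gpow A (- 2^-1)).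
  rewrite -[X in _ *m X](adj_gfun _ A) -/(gpow A _) -Vi.
  by apply: gposdef_conj; rewrite ?unitmx_inv.
by rewrite /ggeomean (gpowE t pS) /cong hV.
Qed.

Lemma herm_rlog A B : herm (rlog A B). Proof. exact: herm_glog. Qed.

Lemma N_rlog A B : gposdef A -> gposdef B -> N (rlog A B) = pdm A B.
Proof.
move=> pA pB; have [Vu _ _ AE] := gpow_half pA.
rewrite -[in RHS](cong_rlog pA pB) [X in pdm X _]AE pdm_cong //; exact: herm_rlog.
Qed.

Lemma re_im_inj (x y : C) : re x = re y -> im x = im y -> x = y.
Proof.
move=> rxy ixy; apply/eqP; rewrite -subr_eq0; apply/eqP.
by apply: re_im0; rewrite ?reD ?imD ?reN ?imN ?rxy ?ixy subrr.
Qed.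

(* A real matrix stores the real (symmetric) and imaginary (antisymmetric) parts
   of a Hermitian matrix. *)
Definition hmat (B : 'M[R]_m) : M :=
  \matrix_(i, j) mkc C (B i j + B j i) (B i j - B j i).

Lemma herm_hmat (B : 'M[R]_m) : herm (hmat B).
Proof.
apply/matrixP => i j; rewrite !mxE; apply: re_im_inj.
  by rewrite re_conj !re_mkc addrC.
by rewrite im_conj !im_mkc opprB.
Qed.

Lemma hmat_surj H : herm H -> exists B : 'M[R]_m, hmat B = H.
Proof.
move=> hH; exists (\matrix_(i, j) ((re (H i j) + im (H i j)) / 2)).
apply/matrixP => i j; have /matrixP/(_ j i) := hH; rewrite !mxE => E.
apply: re_im_inj; rewrite ?re_mkc ?im_mkc -E ?re_conj ?im_conj; lra.
Qed.

Lemma N2_hmat (B B' : 'M[R]_m) :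
  N (hmat B - hmat B') ^+ 2 = 4 * \sum_i \sum_j (B i j - B' i j) ^+ 2.
Proof.
pose D i j := B i j - B' i j.
have -> : N (hmat B - hmat B') ^+ 2 =
    \sum_i \sum_j (2 * D i j ^+ 2) + \sum_i \sum_j (2 * D j i ^+ 2).
  rewrite N2_sum -big_split; apply: eq_bigr => i _.
  rewrite -big_split; apply: eq_bigr => j _ /=.
  by rewrite !mxE reD imD reN imN !re_mkc !im_mkc /D; ring.
rewrite [X in _ + X]exchange_big -mulr2n.
rewrite (_ : 4 = 2 * 2) -?mulrA; last by lra.
rewrite mulr_natl; congr (_ *+ 2).
by rewrite mulr_sumr; apply: eq_bigr => i _; rewrite mulr_sumr.
Qed.

Lemma N_entry_sqr A i j : re (A i j) ^+ 2 + im (A i j) ^+ 2 <= N A ^+ 2.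
Proof.
rewrite N2_sum (bigD1 i) //= (bigD1 j) //= -addrA lerDl.
by rewrite addr_ge0 //; repeat (apply: sumr_ge0 => ? _);
  rewrite addr_ge0 ?sqr_ge0.
Qed.

Lemma N_le_entries A (a : R) : 0 <= a ->
  (forall i j, re (A i j) ^+ 2 + im (A i j) ^+ 2 <= a ^+ 2) -> N A <= m%:R * a.
Proof.
move=> a0 h; rewrite -ler_sqr ?nnegrE ?N_ge0 ?mulr_ge0 // N2_sum.
apply: (@le_trans _ _ (\sum_(i < m) \sum_(j < m) a ^+ 2)).
  by apply: ler_sum => i _; apply: ler_sum => j _; exact: h.
rewrite !sumr_const !card_ord -mulrnA exprMn -natrX mulr_natl.
by rewrite expnS expn1.
Qed.

Lemma norm_rc (z : C) : exists2 r : R, 0 <= r & `|z| = r%:C /\ r ^+ 2 = re z ^+ 2 + im z ^+ 2.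
Proof.
have zr : `|z| \is Num.real by exact: normr_real.
exists (re `|z|); first by rewrite -(rc_ge0 C) rcK.
split; first by rewrite rcK.
rewrite -(re_rc C (_ ^+ 2)) rmorphXn rcK // normCK re_mulJ.
by rewrite -!expr2.
Qed.

Lemma norm_lt_rc (z : C) (e : R) : 0 < e ->
  (`|z| < e%:C) = (re z ^+ 2 + im z ^+ 2 < e ^+ 2).
Proof.
move=> e0; have [r r0 [-> <-]] := norm_rc z.
by rewrite rc_lt ltr_sqr // nnegrE ltW.
Qed.

Lemma pos_rc (e : C) : 0 < e -> exists2 r : R, 0 < r & e = r%:C.
Proof.
move=> e0; have er : e \is Num.real by exact: gtr0_real.
by exists (re e); rewrite ?rcK // -(rc_gt0 C) rcK.
Qed.

Lemma mx_ball_N (A B : M) (e : R) : 0 < e -> N (A - B) < e ->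
  ball (A : ('M[C]_m : normedModType C)) e%:C B.
Proof.
move=> e0 AB; split; first by rewrite rc_gt0.
move=> i j; rewrite /ball /= norm_lt_rc //.
have := N_entry_sqr (A - B) i j; rewrite !mxE => h; apply: le_lt_trans h _.
by rewrite ltr_sqr ?nnegrE ?N_ge0 // ltW.
Qed.

Lemma N_open (U : set ('M[C]_m : normedModType C)) :
  (forall A, U A -> exists2 e : R, 0 < e & forall B, N (A - B) < e -> U B) -> open U.
Proof.
move=> h; rewrite openE => A /h[e e0 eU]; apply/nbhs_ballP.
(* Dividing by m + 1 rather than m keeps the radius positive for matrices of size 0 and makes the
   final inequality strict. *)
have m0 : 0 < m%:R + 1 :> R by rewrite ltr_wpDl.
have e0' : 0 < e / (m%:R + 1) by rewrite divr_gt0.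
exists (e / (m%:R + 1))%:C; first by rewrite /= rc_gt0.
move=> B [_ AB]; apply: eU.
apply: (@le_lt_trans _ _ (m%:R * (e / (m%:R + 1)))).
  apply: N_le_entries => [|i j]; first exact: ltW.
  have := AB i j; rewrite /ball /= norm_lt_rc // => /ltW.
  by rewrite !mxE.
by rewrite mulrA ltr_pdivrMr // mulrDr mulr1 mulrC ltrDl.
Qed.

Lemma open_N (U : set ('M[C]_m : normedModType C)) A : open U -> U A ->
  exists2 e : R, 0 < e & forall B, N (A - B) < e -> U B.
Proof.
rewrite openE => Uo /Uo /nbhs_ballP[_ /pos_rc[e e0 ->] eU].
by exists e => // B AB; apply: eU; exact: mx_ball_N.
Qed.

Lemma cvg_N (T : Type) (F : set_system T) (f : T -> M) (D : M) : Filter F ->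
  (forall e : R, 0 < e -> \forall x \near F, N (f x - D) < e) ->
  (f : T -> ('M[C]_m : normedModType C)) @ F --> (D : ('M[C]_m : normedModType C)).
Proof.
move=> FF h; apply/cvg_ballP => _ /pos_rc[e e0 ->].
near=> x; apply: mx_ball_N => //.
by rewrite -opprB NN; near: x; exact: h.
Unshelve. all: end_near. Qed.

End Charts.

(** * The metric space P_m and the quadruple comparison *)

Section MetricSpace.
Variables (R : realType) (m : nat).
Local Notation cm := (complex_model R).
Local Notation P := (Pm R m).
Implicit Types (A B X Y Z : P).

Lemma mfun_gfun f (A : 'M[R[i]]_m) : Defs.mfun f A = gfun (C := cm) f A.
Proof. by rewrite /gfun unlock. Qed.

Lemma mlogE (A : 'M[R[i]]_m) : mlog A = glog (C := cm) A.
Proof. exact: mfun_gfun. Qed.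

Lemma mpow_gpow (A : 'M[R[i]]_m) t : mpow A t = gpow (C := cm) A t.
Proof. exact: mfun_gfun. Qed.

(* Sealed, so that comparing two distances does not unfold matrix computations. *)
Fact rdist_seal : {f : P -> P -> R | f = @pdist R m}.
Proof. by exists (@pdist R m). Qed.

Definition rdist : P -> P -> R := sval rdist_seal.

Lemma rdistE : rdist = @pdist R m.
Proof. exact: (svalP rdist_seal). Qed.

Definition pm (A : P) : 'M[cm]_m := pval A.

Lemma rdist_pdm A B : rdist A B = pdm (C := cm) (pm A) (pm B).
Proof. by rewrite rdistE /pdist mlogE !mpow_gpow. Qed.

Lemma pm_posdef A : gposdef (C := cm) (pm A).
Proof. exact: (asboolW (valP (A : PD R m))). Qed.

Definition mkPm (M : 'M[cm]_m) (pM : gposdef (C := cm) M) : P :=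
  exist _ M (asboolT pM).

Lemma pm_inj A B : pm A = pm B -> A = B.
Proof. by move=> AB; apply: (@val_inj _ _ (PD R m)). Qed.

Lemma rdist_ge0 A B : 0 <= rdist A B.
Proof. by rewrite rdist_pdm pdm_ge0. Qed.

Lemma rdist_sym A B : rdist A B = rdist B A.
Proof. by rewrite !rdist_pdm (pdm_sym (pm_posdef A) (pm_posdef B)). Qed.

Lemma rdist_triangle A B Z : rdist A B <= rdist A Z + rdist Z B.
Proof.
rewrite !rdist_pdm.
exact: (pdm_triangle (pm_posdef A) (pm_posdef B) (pm_posdef Z)).
Qed.

Lemma rdist_midpoint A B : exists Y, forall Z,
  2 * rdist Z Y ^+ 2 + rdist A B ^+ 2 / 2 <= rdist Z A ^+ 2 + rdist Z B ^+ 2.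
Proof.
have [Y pY h] := pdm_midpoint_ex (pm_posdef A) (pm_posdef B).
exists (mkPm pY) => Z; rewrite !rdist_pdm; exact: (h _ (pm_posdef Z)).
Qed.

Lemma rdist_subdivide A B n : exists q : nat -> P, [/\ q 0%N = A, q n.+1 = B &
  forall k, rdist (q k) (q k.+1) = rdist A B / n.+1%:R].
Proof.
have [q [pq q0 qn dq]] := pdm_subdivide n (pm_posdef A) (pm_posdef B).
exists (fun k => mkPm (pq k)); split=> [||k]; last by rewrite !rdist_pdm; exact: dq.
- exact: pm_inj.
- exact: pm_inj.
Qed.

Lemma rdist_diff A B Z : `|rdist A Z - rdist B Z| <= rdist A B.
Proof.
have := rdist_triangle A Z B; have := rdist_triangle B Z A.
by rewrite (rdist_sym B A) ler_norml => *; apply/andP; split; lra.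
Qed.

(** The semiparallelogram law is applied from A and from X to the midpoint Z of the diagonal BY; for
    the other diagonal, AX^2 <= (AZ + ZX)^2 <= 2 (AZ^2 + ZX^2). *)
Lemma rdist_quad_weak A B X Y :
  rdist A X ^+ 2 + rdist B Y ^+ 2 - rdist B X ^+ 2 - rdist A Y ^+ 2 <=
  rdist A B ^+ 2 + rdist X Y ^+ 2.
Proof.
have [Z h] := rdist_midpoint B Y.
have hA := h A; have hX := h X.
have t := rdist_triangle A X Z.
rewrite (rdist_sym X B) in hX; rewrite (rdist_sym Z X) in t.
have := rdist_ge0 A X; have := rdist_ge0 A Z; have := rdist_ge0 X Z.
move: hA hX t.
move: (rdist A X) (rdist A Z) (rdist X Z) (rdist B Y) (rdist A B) (rdist A Y)
  (rdist B X) (rdist X Y) => a b c d e f g i hA hX t c0 b0 a0.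
have : a ^+ 2 <= (b + c) ^+ 2 by rewrite ler_sqr ?nnegrE ?addr_ge0.
have := sqr_ge0 (b - c); rewrite sqrrB sqrrD; nra.
Qed.

(** The left side is additive when XY is cut, so the weak form is summed over n + 1 pieces, each of
    length XY / (n + 1). *)
Lemma rdist_quad_subdivide A B X Y n :
  rdist A X ^+ 2 + rdist B Y ^+ 2 - rdist B X ^+ 2 - rdist A Y ^+ 2 <=
  n.+1%:R * rdist A B ^+ 2 + rdist X Y ^+ 2 / n.+1%:R.
Proof.
have [q [q0 qn dq]] := rdist_subdivide X Y n.
have step k : rdist A (q 0%N) ^+ 2 + rdist B (q k) ^+ 2 - rdist B (q 0%N) ^+ 2 -
    rdist A (q k) ^+ 2 <=
    k%:R * (rdist A B ^+ 2 + (rdist X Y / n.+1%:R) ^+ 2).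
  elim: k => [|k IH]; first by rewrite mul0r; lra.
  have := rdist_quad_weak A B (q k) (q k.+1); rewrite dq -[k.+1%:R]natr1 [X in _ -> _ <= X]mulrDl mul1r.
  by move: IH; move: (rdist X Y / _) => v; move: (k%:R * (_ + v ^+ 2)) => u; lra.
have := step n.+1; rewrite q0 qn => h; apply: le_trans h _.
rewrite mulrDr lerD2l le_eqVlt; apply/orP; left; apply/eqP; field.
by rewrite ?nat1r ?natr1 pnatr_eq0.
Qed.

(** For a > 0 take n = floor(b/a): then (n + 1) a^2 <= ab + a^2 <= 2ab and b^2 / (n + 1) <= ab,
    whence 3. For a = 0, let n tend to infinity. *)
Lemma ler_quad_subdivide (a b q : R) : 0 <= a -> a <= b ->
  (forall n, q <= n.+1%:R * a ^+ 2 + b ^+ 2 / n.+1%:R) -> q <= 3 * (a * b).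
Proof.
move=> a0 ab h; have [a00|an] := eqVneq a 0.
  rewrite a00 mul0r mulr0; apply: (@le_add_harmonic _ _ _ (b ^+ 2)) => n.
  by have := h n; rewrite a00 expr0n mulr0.
have ap : 0 < a by rewrite lt_def an.
have b0 : 0 <= b by apply: le_trans ab.
have /andP[n1 n2] := @truncn_itv R (b / a) (divr_ge0 b0 a0).
have n0 : 0 < (Num.truncn (b / a)).+1%:R :> R by rewrite ltr0n.
apply: le_trans (h (Num.truncn (b / a))) _.
move: n1 n2 n0; rewrite ler_pdivlMr // ltr_pdivrMr // -natr1.
move: (Num.truncn (b / a))%:R => k n1 n2 n0.
have : b ^+ 2 / (k + 1) <= a * b.
  by rewrite ler_pdivrMr // expr2 mulrAC ler_wpM2r // ltW // mulrC.
nra.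
Qed.

Lemma rdist_quadruple A B X Y :
  rdist A X ^+ 2 + rdist B Y ^+ 2 - rdist B X ^+ 2 - rdist A Y ^+ 2 <=
  3 * (rdist A B * rdist X Y).
Proof.
(* The left side is unchanged when (A, B) and (X, Y) are exchanged, so the longer of the two
   segments can be the one subdivided. *)
have [le|/ltW le] := leP (rdist A B) (rdist X Y).
  apply: ler_quad_subdivide => //; first exact: rdist_ge0.
  exact: rdist_quad_subdivide.
rewrite (mulrC (rdist A B)); apply: ler_quad_subdivide => //; first exact: rdist_ge0.
move=> n; have := rdist_quad_subdivide X Y A B n.
rewrite (rdist_sym X A) (rdist_sym Y B) (rdist_sym Y A) (rdist_sym X B) => h.
apply: le_trans h; lra.
Qed.

(** * Topology and measurability *)

Definition dcont (h : P -> R) := forall A (e : R), 0 < e ->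
  exists2 r : R, 0 < r & forall B, rdist A B < r -> `|h A - h B| < e.

(** The Borel sets are generated by traces of entrywise open sets of matrices, so O is exhibited as
    such a trace: U is the union of the entrywise balls centred in O whose trace lies in O, and
    [pdm_near_ex] provides one around each point. *)
Lemma dopen_measurable (O : set P) :
  (forall A, O A -> exists2 r : R, 0 < r & forall B, rdist A B < r -> O B) ->
  measurable O.
Proof.
move=> hO; apply: sub_sigma_algebra.
pose U : set ('M[cm]_m : normedModType cm) := [set M | exists A (e : R),
  [/\ 0 < e, forall B, N (C := cm) (pm A - pm B) < e -> O B &
      N (C := cm) (pm A - M) < e]].
exists U; last first.
  apply/seteqP; split=> [B [A [e [e0 h1 h2]]]|A OA]; first exact: (h1 B).
  have [r r0 h] := hO A OA.
  have [e [c [e0 c0 near]]] := pdm_near_ex (pm_posdef A).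
  exists A, (Order.min e (r / (c + 1))); split.
  - by rewrite lt_min e0 divr_gt0 // ltr_wpDl.
  - move=> B; rewrite (N_subC (pm A)) lt_min => /andP[Be Br].
    apply: h; rewrite rdist_pdm; apply: le_lt_trans (near _ (pm_posdef B) Be) _.
    have c1 : 0 < c + 1 by rewrite ltr_wpDl.
    move: Br; rewrite ltr_pdivlMr //.
    have := N_ge0 (C := cm) (pm B - pm A); nra.
  - by rewrite (N_subxx (pm A)) lt_min e0 divr_gt0 // ltr_wpDl.
apply: (@N_open R cm m) => M [A [e [e0 h1 h2]]].
exists (e - N (C := cm) (pm A - M)); first by rewrite subr_gt0.
move=> M' MM'; exists A, e; split; [exact: e0|exact: h1|].
apply: le_lt_trans (N_sub_triangle (pm A) M M') _.
by rewrite -ltrBrDl.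
Qed.

Lemma dcont_measurable (h : P -> R) : dcont h -> measurable_fun setT h.
Proof.
move=> hc; apply: (measurability _ (measurable_realfun.RGenOInfty.measurableE R)) => _ [_ [x ->] <-].
rewrite setTI; apply: dopen_measurable => A /=.
rewrite in_itv /= andbT => hA.
have hx : 0 < h A - x by rewrite subr_gt0.
have [r r0 hr] := hc A _ hx.
exists r => // B /hr; rewrite in_itv /= andbT ltr_norml => /andP[_]; lra.
Qed.

Lemma dcont_lip (h : P -> R) : (forall A B, `|h A - h B| <= rdist A B) -> dcont h.
Proof. by move=> hl A e e0; exists e => // B; apply: le_lt_trans. Qed.

Definition dcontP (h : P -> P) := forall A (e : R), 0 < e ->
  exists2 r : R, 0 < r & forall B, rdist A B < r -> rdist (h A) (h B) < e.

Lemma dcont_comp (g : P -> R) (h : P -> P) : dcont g -> dcontP h -> dcont (g \o h).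
Proof.
move=> gc hc A e e0; have [r r0 hr] := gc (h A) e e0.
have [s s0 hs] := hc A r r0; exists s => // B /hs; exact: hr.
Qed.

(** By [pdm_near_N] a small d-ball lies in a given entrywise ball, so preimages of the generating
    sets are open for d. *)
Lemma dcontP_measurable (h : P -> P) : dcontP h -> measurable_fun setT h.
Proof.
move=> hc; apply: (@measurability _ _ P P setT h (@borelPD R m)) => //.
move=> _ [_ [U oU <-] <-]; rewrite setTI.
apply: dopen_measurable => A /= hA.
have [e e0 eU] := @open_N R cm m U _ oU hA.
have [V Vu AE] := gposdef_factor (pm_posdef (h A)).
have [r r0 hr] := pdm_near_N 0 Vu e0; rewrite -AE in hr.
have [s s0 hs] := hc A r r0; exists s => // B /hs hAB.
apply: eU; have := hr _ (pm_posdef (h B)); rewrite -rdist_pdm => /(_ hAB).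
by rewrite N_subC.
Qed.

End MetricSpace.

(** * Linearisation along a geodesic and the law of cosines *)

Section DerivativeGeometry.
Local Open Scope sesquilinear_scope.
Variables (R : realType) (C : complexification R) (m : nat).
Local Notation M := 'M[C]_m.
Local Notation "x %:C" := (rc C x) : ring_scope.
Implicit Types (A B G H K L P X Y Z U V W : M) (d e : 'I_m -> R) (f g : R -> R).
#[local] Hint Resolve herm_gexp herm_glog herm0 herm1 : core.

Lemma cong_cont V H (e : R) : V \in unitmx -> herm H -> 0 < e ->
  exists2 r : R, 0 < r & forall K, herm K -> N (K - H) < r ->
    pdm (cong V H) (cong V K) < e.
Proof.
move=> Vu hH e0; have [r r0 hr] := gexp_pdm_cont hH e0.
exists r => // K hK /(hr K hK); rewrite /cong pdm_congruence //; exact: gposdef_gexp.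
Qed.

Lemma N_rlog_sub X A B : gposdef X -> gposdef A -> gposdef B ->
  N (rlog X A - rlog X B) <= pdm A B.
Proof.
move=> pX pA pB; have [Vu _ _ _] := gpow_half pX.
have := N_sub_le_pdm Vu (herm_rlog X A) (herm_rlog X B).
by rewrite !cong_rlog.
Qed.

(* The logarithm of [cong V (t L)] in the frame of [cong V (t K)]. *)
Definition shift_log K (t : R) L := glog (cong (gexp ((- t / 2)%:C *: K)) (t%:C *: L)).

Definition trotter_err K (t : R) L := N (shift_log K t L - t%:C *: (L - K)).

Lemma cong_shift_log V K (t : R) L : V \in unitmx -> herm K ->
  cong (V *m gexp ((t / 2)%:C *: K)) (shift_log K t L) = cong V (t%:C *: L).
Proof.
move=> Vu hK; set F := gexp _.
have Eu : gexp ((- t / 2)%:C *: K) \in unitmx by apply: gexp_unit; apply: hermZ.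
have FE : F *m gexp ((- t / 2)%:C *: K) = 1%:M.
  by rewrite /F gexpD // -mulrDl subrr mul0r rmorph0 scale0r gexp0.
have pS : gposdef (cong (gexp ((- t / 2)%:C *: K)) (t%:C *: L)) by exact: gposdef_cong.
rewrite cong_mul; congr (_ *m _ *m _).
by rewrite -[LHS]/(F *m gexp (glog _) *m F ^t*) (gexp_log pS) -cong_mul FE cong_id.
Qed.

(** The norm of [shift_log] is the distance between two geodesic points; passing through their
    common origin V V^* bounds it by |t| (|L| + |K|), and the linear term contributes as much again.
    Being valid for every t, this provides the integrable majorant. *)
Lemma trotter_err_le V K (t : R) L : V \in unitmx -> herm K -> herm L ->
  trotter_err K t L <= 2 * `|t| * (N L + N K).
Proof.
move=> Vu hK hL; set W := V *m gexp ((t / 2)%:C *: K).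
have Wu : W \in unitmx by rewrite unitmx_mul Vu gexp_unit //; exact: hermZ.
have hS : herm (shift_log K t L) by exact: herm_glog.
have W0 : cong W 0 = cong V (t%:C *: K).
  by rewrite /W cong_mul cong0 gexp_half.
have NS : N (shift_log K t L) <= `|t| * (N L + N K).
  rewrite -(pdm_cong Wu hS) W0 cong_shift_log //.
  have pc H : gposdef (cong V H) by exact: gposdef_cong.
  apply: le_trans (pdm_triangle (pc _) (pc _) (pc 0)) _.
  rewrite (pdm_sym (pc _) (pc 0)) !pdm_cong ?NZ //; try exact: hermZ.
  by rewrite mulrDr addrC.
apply: le_trans (N_triangle _ _) _; rewrite NN NZ.
have := N_triangle L (- K); rewrite NN => h.
have := ler_wpM2l (normr_ge0 t) h; lra.
Qed.

(** Its purpose is measurability: it makes the error a continuous function of the point with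
    coordinate L. *)
Lemma trotter_err_lip V K (t : R) G L : V \in unitmx -> herm K -> herm G -> herm L ->
  `|trotter_err K t G - trotter_err K t L| <=
  pdm (cong V (t%:C *: G)) (cong V (t%:C *: L)) + `|t| * N (G - L).
Proof.
move=> Vu hK hG hL; apply: le_trans (N_dist _ _) _.
have -> : shift_log K t G - t%:C *: (G - K) - (shift_log K t L - t%:C *: (L - K)) =
    (shift_log K t G - shift_log K t L) - t%:C *: (G - L).
  by apply/matrixP => i j; rewrite !mxE; ring.
apply: le_trans (N_triangle _ _) _; rewrite NN NZ lerD2r.
have Wu : V *m gexp ((t / 2)%:C *: K) \in unitmx.
  by rewrite unitmx_mul Vu gexp_unit //; exact: hermZ.
rewrite -(cong_shift_log t G Vu hK) -(cong_shift_log t L Vu hK).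
by apply: N_sub_le_pdm; try exact: herm_glog.
Qed.

(** In the chart centred at cong V (tK), the right side is at least |H - S|^2 with S =
    [shift_log K t L]. Replacing S by t (L - K) in the cross term costs 2 |H| times the Trotter
    error; what is left is linear in L - K and will integrate to 0. *)
Lemma cosine_law V K (t : R) Y : V \in unitmx -> herm K -> gposdef Y ->
  exists H, [/\ herm H, Y = cong (V *m gexp ((t / 2)%:C *: K)) H &
    forall L, herm L ->
      pdm (cong V (t%:C *: K)) (cong V (t%:C *: L)) ^+ 2 + N H ^+ 2
      - 2 * N H * trotter_err K t L - 2 * t * ip H (L - K)
      <= pdm Y (cong V (t%:C *: L)) ^+ 2].
Proof.
move=> Vu hK pY; set W := V *m gexp ((t / 2)%:C *: K).
have Wu : W \in unitmx by rewrite unitmx_mul Vu gexp_unit //; exact: hermZ.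
have W0 : cong W 0 = cong V (t%:C *: K).
  by rewrite /W cong_mul cong0 gexp_half.
have [H hH YE] := cong_surj Wu pY; exists H; split=> // L hL.
have hS : herm (shift_log K t L) by exact: herm_glog.
have AE : cong W (shift_log K t L) = cong V (t%:C *: L) by exact: cong_shift_log.
rewrite -W0 -AE pdm_cong // YE.
have le1 := N_sub_le_pdm Wu hH hS.
have N0' := N_ge0 (H - shift_log K t L).
have le2 : N (H - shift_log K t L) ^+ 2 <=
    pdm (cong W H) (cong W (shift_log K t L)) ^+ 2.
  by rewrite ler_sqr ?nnegrE // (le_trans N0').
apply: le_trans le2; rewrite N2B.
have ipD : ip H (shift_log K t L) =
    ip H (shift_log K t L - t%:C *: (L - K)) + t * ip H (L - K).
  by rewrite -ipZr -ipDr subrK.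
have CS := N_Cauchy_Schwarz H (shift_log K t L - t%:C *: (L - K)).
rewrite ipD /trotter_err; lra.
Qed.

Lemma cong_derivative V K : herm K -> exists2 c : R, 0 <= c & forall t H,
  `|t| <= 1 -> herm H -> N H <= 1 ->
  N (cong (V *m gexp ((t / 2)%:C *: K)) H - cong V 0 - t%:C *: (V *m K *m V ^t*)) <=
  c * (t ^+ 2 + N H).
Proof.
move=> hK; have [c c0 hc] := cong_exp_taylor hK.
exists (N V * c * N V); first by rewrite !mulr_ge0 ?N_ge0.
move=> t H t1 hH H1; set E := gexp _.
have -> : cong (V *m E) H - cong V 0 - t%:C *: (V *m K *m V ^t*) =
    V *m (cong E H - 1%:M - t%:C *: K) *m V ^t*.
  rewrite cong_mul cong0 !mulmxBr !mulmxBl mulmx1.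
  by rewrite -scalemxAr -scalemxAl.
apply: le_trans (N_mul _ _) _; rewrite N_adj mulrAC ler_wpM2r ?N_ge0 //.
apply: le_trans (N_mul _ _) _; rewrite -mulrA ler_wpM2l ?N_ge0 //.
exact: hc.
Qed.

Lemma N_div_t A B (t : R) : t != 0 ->
  N ((t%:C)^-1 *: A - B) = `|t|^-1 * N (A - t%:C *: B).
Proof.
move=> t0; rewrite -normfV -NZ fmorphV scalerBr scalerA.
by rewrite mulVf ?fmorph_eq0 // scale1r.
Qed.

Lemma re_entry_le A B i j : `|re (A i j) - re (B i j)| <= N (A - B).
Proof.
have [h _] := N_entry (A - B) i j; move: h.
by rewrite !mxE reD reN.
Qed.

Lemma im_entry_le A B i j : `|im (A i j) - im (B i j)| <= N (A - B).
Proof.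
have [_ h] := N_entry (A - B) i j; move: h.
by rewrite !mxE imD imN.
Qed.

End DerivativeGeometry.

(** * Minimisers of the integrated squared distance *)

Section Barycenters.
Variables (R : realType) (m : nat) (mu : probability (Pm R m) R).
Local Notation cm := (complex_model R).
Local Notation P := (Pm R m).
Implicit Types (A B X Y Z : P) (f g : P -> R) (h k : P -> P).

Definition rintegrable f := mu.-integrable [set: P] (EFin \o f).

Local Notation E f := (Rintegral mu setT f).

Lemma rintegrable_measurable f : rintegrable f -> measurable_fun setT f.
Proof. by move=> /measurable_int/measurable_EFinP. Qed.

Lemma rintegrable_dom f g : measurable_fun setT f -> rintegrable g ->
  (forall A, `|f A| <= g A) -> rintegrable f.
Proof.
move=> mf ig fg; apply: le_integrable ig => //; first exact/measurable_EFinP.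
by move=> A _ /=; rewrite lee_fin (le_trans (fg A)) // ler_norm.
Qed.

Lemma rintegrableD f g : rintegrable f -> rintegrable g ->
  rintegrable (fun A => f A + g A).
Proof. by move=> hf hg; exact: (integrableD measurableT hf hg). Qed.

Lemma rintegrableB f g : rintegrable f -> rintegrable g ->
  rintegrable (fun A => f A - g A).
Proof. by move=> hf hg; exact: (integrableB measurableT hf hg). Qed.

Lemma rintegrableZ (c : R) f : rintegrable f -> rintegrable (fun A => c * f A).
Proof. by move=> hf; exact: (integrableZl measurableT c hf). Qed.

Lemma rintegrable_cst (c : R) : rintegrable (fun=> c).
Proof. exact: finite_measure_integrable_cst. Qed.

Lemma RintD f g : rintegrable f -> rintegrable g ->
  E (fun A => f A + g A) = E f + E g.
Proof. exact: RintegralD. Qed.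

Lemma RintB f g : rintegrable f -> rintegrable g ->
  E (fun A => f A - g A) = E f - E g.
Proof. exact: RintegralB. Qed.

Lemma RintZ (c : R) f : rintegrable f -> E (fun A => c * f A) = c * E f.
Proof. exact: RintegralZl. Qed.

Lemma Rint_cst (c : R) : E (fun=> c) = c.
Proof.
rewrite Rintegral_cst //; have := @probability_setT _ _ _ mu.
by move=> /(congr1 fine) /= ->; rewrite mulr1.
Qed.

Lemma le_Rint f g : rintegrable f -> rintegrable g -> (forall A, f A <= g A) -> E f <= E g.
Proof. by move=> hf hg fg; apply: le_Rintegral. Qed.

Lemma Rint_ge0 f : (forall A, 0 <= f A) -> 0 <= E f.
Proof. by move=> f0; exact: Rintegral_ge0. Qed.

(** The push-forward of mu by h has finite first moment. Keeping h beside mu, instead of forming the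
    measure, couples two pushed measures under a single integral. *)
Definition admissible h :=
  measurable_fun setT h /\ forall Z, rintegrable (fun A => rdist Z (h A)).

Definition obj h Z := E (fun A => rdist Z (h A) ^+ 2 - rdist (PD1 R m : P) (h A) ^+ 2).

Lemma sqr_rdist_diff Z Y A :
  `|rdist Z A ^+ 2 - rdist Y A ^+ 2| <= rdist Z Y * (rdist Z A + rdist Y A).
Proof.
rewrite subr_sqr normrM; apply: ler_pM => //; first exact: rdist_diff.
by rewrite ger0_norm // addr_ge0 ?rdist_ge0.
Qed.

(** A first moment controls the difference of two squared distances, which grows only linearly,
    although it need not control either square. *)
Lemma rintegrable_sqr_diff h Z Y : admissible h ->
  rintegrable (fun A => rdist Z (h A) ^+ 2 - rdist Y (h A) ^+ 2).
Proof.
move=> [_ ah]; have iZ := ah Z; have iY := ah Y.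
apply: (@rintegrable_dom _ (fun A => rdist Z Y * (rdist Z (h A) + rdist Y (h A)))).
- by apply: measurable_funB; apply: measurable_funX; apply: rintegrable_measurable.
- by apply: rintegrableZ; exact: rintegrableD.
- by move=> A; exact: sqr_rdist_diff.
Qed.

Lemma obj_sub h Z Y : admissible h ->
  obj h Z - obj h Y = E (fun A => rdist Z (h A) ^+ 2 - rdist Y (h A) ^+ 2).
Proof.
move=> ah; rewrite /obj -RintB; try exact: rintegrable_sqr_diff.
by apply: eq_Rintegral => A _; ring.
Qed.

Lemma obj_lipschitz h Z Y : admissible h -> `|obj h Z - obj h Y| <=
  rdist Z Y * (2 * E (fun A => rdist Z (h A)) + rdist Z Y).
Proof.
move=> ah; rewrite obj_sub //; have ih := rintegrable_sqr_diff Z Y ah.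
apply: le_trans (le_normr_Rintegral measurableT ih) _.
have iZ := ah.2 Z.
have -> : rdist Z Y * (2 * E (fun A => rdist Z (h A)) + rdist Z Y) =
    E (fun A => rdist Z Y * (2 * rdist Z (h A) + rdist Z Y)).
  have i1 : rintegrable (fun A => 2 * rdist Z (h A)) by exact: rintegrableZ.
  rewrite RintZ; last by apply: rintegrableD => //; exact: rintegrable_cst.
  by rewrite RintD // ?RintZ ?Rint_cst //; exact: rintegrable_cst.
apply: le_Rint => [||A].
- apply: (@rintegrable_dom _ (fun A => `|rdist Z (h A) ^+ 2 - rdist Y (h A) ^+ 2|)).
  + by apply: measurableT_comp => //; exact: rintegrable_measurable.
  + exact: integrable_norm.
  + by move=> A; rewrite normr_id.
- apply: rintegrableZ; apply: rintegrableD; last exact: rintegrable_cst.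
  exact: rintegrableZ.
- apply: le_trans (sqr_rdist_diff _ _ _) _; rewrite ler_wpM2l ?rdist_ge0 //.
  by have := rdist_triangle Y (h A) Z; rewrite (rdist_sym Y Z); lra.
Qed.

(** Since d(Z, B) >= |d(o, Z) - d(o, B)|, the integrand is at least d(o, Z) (d(o, Z) - 2 d(o, B))
    with B = h(A). The bound 0 is the value of the objective at o. *)
Lemma obj_coercive h Z : admissible h ->
  2 * E (fun A => rdist (PD1 R m : P) (h A)) <= rdist (PD1 R m : P) Z -> 0 <= obj h Z.
Proof.
move=> ah; set o := (PD1 R m : P) => le.
have io := ah.2 o.
apply: (@le_trans _ _ (E (fun A => rdist o Z * (rdist o Z - 2 * rdist o (h A))))).
  have i2 : rintegrable (fun A => 2 * rdist o (h A)) by exact: rintegrableZ.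
  have ic : rintegrable (fun=> rdist o Z) by exact: rintegrable_cst.
  rewrite RintZ; last exact: rintegrableB.
  by rewrite RintB // RintZ // Rint_cst mulr_ge0 ?rdist_ge0 // subr_ge0.
apply: le_Rint => [||A].
- apply: rintegrableZ; apply: rintegrableB; first exact: rintegrable_cst.
  exact: rintegrableZ.
- exact: rintegrable_sqr_diff.
have := rdist_triangle o Z (h A); rewrite (rdist_sym (h A) Z).
have := rdist_triangle o (h A) Z; have := rdist_ge0 Z (h A).
have := rdist_ge0 o (h A); have := rdist_ge0 o Z.
move: (rdist o Z) (rdist o (h A)) (rdist Z (h A)) => a b c; nra.
Qed.

(** Global coordinates at the identity by real row vectors, where compactness of boxes and the
    extreme value theorem are available. *)
Definition chart (v : 'rV[R]_(m * m)) : P := mkPm (gposdef_gexp (hmat cm (vec_mx v))).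

Lemma pm_chart v : pm (chart v) = gexp (hmat cm (vec_mx v)).
Proof. by []. Qed.

Lemma chart_surj Z : exists2 v, chart v = Z &
  forall i, `|v 0 i| <= rdist (PD1 R m : P) Z.
Proof.
have [H hH ZE] := cong_surj (unitmx1 cm m) (pm_posdef Z).
have [B BH] := hmat_surj hH.
exists (mxvec B).
  by apply: pm_inj; rewrite pm_chart mxvecK BH ZE cong_id.
move=> i; have -> : rdist (PD1 R m : P) Z = N H.
  have o1 : cong (C := cm) 1%:M 0 = pm (PD1 R m : P) by rewrite cong_id gexp0.
  by rewrite rdist_pdm ZE -o1; exact: pdm_cong (unitmx1 cm m) hH.
case/mxvec_indexP: i => i j; rewrite mxvecE.
rewrite -ler_sqr ?nnegrE ?N_ge0 // real_normK ?num_real //.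
have := N2_hmat cm B 0.
have -> : hmat cm (0 : 'M[R]_m) = 0.
  by apply/matrixP => k l; rewrite !mxE addr0 subr0; apply: re_im_inj;
    rewrite ?re_mkc ?im_mkc ?re0 ?im0.
rewrite subr0 BH => ->; rewrite (bigD1 i) //= (bigD1 j) //= mxE subr0.
set s := \sum_(_ | _) _; set u := \sum_(_ | _) _.
have s0 : 0 <= s by apply: sumr_ge0 => *; exact: sqr_ge0.
have u0 : 0 <= u by apply: sumr_ge0 => *; apply: sumr_ge0 => *; exact: sqr_ge0.
have := sqr_ge0 (B i j); move: (B i j ^+ 2) => b; lra.
Qed.

Lemma chart_cont v (e : R) : 0 < e -> exists2 r : R, 0 < r &
  forall w, ball v r w -> rdist (chart v) (chart w) < e.
Proof.
move=> e0; have [r r0 hr] := gexp_pdm_cont (herm_hmat cm (vec_mx v)) e0.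
have m0 : 0 < 2 * m%:R + 1 :> R by rewrite ltr_wpDl ?mulr_ge0.
exists (r / (2 * m%:R + 1)); first by rewrite divr_gt0.
move=> w [_ vw]; rewrite rdist_pdm; apply: (hr _ (herm_hmat cm (vec_mx w))).
set d := r / _ in vw *; have d0 : 0 < d by rewrite divr_gt0.
apply: (@le_lt_trans _ _ (2 * m%:R * d)); last first.
  by rewrite /d mulrA ltr_pdivrMr // mulrDr mulr1 mulrC ltrDl.
have dd : 0 <= 2 * m%:R * d by rewrite mulr_ge0 ?mulr_ge0 // ltW.
rewrite -ler_sqr ?nnegrE ?N_ge0 // N2_hmat.
have -> : (2 * m%:R * d) ^+ 2 = 4 * \sum_(i < m) \sum_(j < m) d ^+ 2.
  rewrite !sumr_const !card_ord -mulrnA -[d ^+ 2 *+ _]mulr_natl natrM; ring.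
rewrite ler_wpM2l //; apply: ler_sum => i _; apply: ler_sum => j _.
rewrite !mxE -real_normK ?num_real // ler_sqr ?nnegrE ?(ltW d0) //.
rewrite ltW //; have := vw 0 (mxvec_index i j); by rewrite /ball /= distrC.
Qed.

(** The radius r is the threshold of [obj_coercive], and the box of coordinates contains the d-ball
    of radius r about o. The minimum over the box is at most the value 0 at o, hence also at most
    every value outside the ball. *)
Lemma obj_minimizer h : admissible h -> exists G, forall Z, obj h G <= obj h Z.
Proof.
move=> ah; set o := (PD1 R m : P).
pose r := 2 * E (fun A => rdist o (h A)).
have r0 : 0 <= r by rewrite mulr_ge0 // Rint_ge0 // => A; exact: rdist_ge0.
pose K : set 'rV[R]_(m * m) := [set v | forall i, `|v 0 i| <= r].
have Kc : compact K.
  have -> : K = [set v | forall i, `[- r, r]%classic (v 0 i)].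
    by apply/seteqP; split=> v /= Kv i; have := Kv i; rewrite /= in_itv /= ler_norml.
  apply: (@rV_compact _ _ (fun=> `[- r, r]%classic)) => i.
  exact: segment_compact.
have K0 : K !=set0 by exists 0 => i; rewrite mxE normr0.
have fc : {within K, continuous (fun v => obj h (chart v))}.
  apply: continuous_subspaceT => v.
  apply/(@cvgrPdist_lt _ _ _ _ (nbhs_filter v)) => e e0.
  set c := 2 * E (fun A => rdist (chart v) (h A)) + 1.
  have c0 : 0 < c.
    by rewrite ltr_wpDl // mulr_ge0 // Rint_ge0 // => A; exact: rdist_ge0.
  have e1 : 0 < Order.min 1 (e / c) by rewrite lt_min ltr01 divr_gt0.
  have [d d0 hd] := chart_cont v e1.
  apply/nbhs_ballP; exists d => // w /hd; rewrite lt_min => /andP[d1 de].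
  apply: le_lt_trans (obj_lipschitz _ _ ah) _.
  move: de; rewrite ltr_pdivlMr // => de; apply: le_lt_trans de.
  rewrite ler_wpM2l ?rdist_ge0 // /c lerD2l; exact: ltW.
have [v0 v0K vmin] := EVT_min_rV K0 Kc fc.
have o_min : obj h (chart v0) <= 0.
  have [v vo vK] := chart_surj o.
  have -> : 0 = obj h (chart v).
    by rewrite vo /obj -[LHS](Rint_cst 0); apply: eq_Rintegral => A _; rewrite subrr.
  apply: vmin; rewrite inE => i; apply: le_trans (vK i) _.
  by rewrite rdist_pdm (pdmxx (pm_posdef o)).
exists (chart v0) => Z; have [le|/ltW le] := leP (rdist o Z) r.
  have [v vZ vK] := chart_surj Z; rewrite -vZ.
  by apply: vmin; rewrite inE => i; apply: le_trans (vK i) _.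
exact: le_trans o_min (obj_coercive ah le).
Qed.

(** The semiparallelogram law at the midpoint Y of Z and G is integrated, and minimality of G
    discards the term at Y. A single midpoint yields the factor 1/2, where the sharp one is 1. *)
Lemma obj_variance h G Z : admissible h -> (forall Y, obj h G <= obj h Y) ->
  rdist Z G ^+ 2 / 2 <= obj h Z - obj h G.
Proof.
move=> ah Gmin; have [Y hY] := rdist_midpoint Z G.
have YG : 0 <= obj h Y - obj h G by rewrite subr_ge0.
have iZG := rintegrable_sqr_diff Z G ah; have iYG := rintegrable_sqr_diff Y G ah.
have := le_Rint (f := fun A => 2 * (rdist Y (h A) ^+ 2 - rdist G (h A) ^+ 2) +
  rdist Z G ^+ 2 / 2) (rintegrableD (rintegrableZ 2 iYG) (rintegrable_cst _)) iZG.
rewrite RintD; [|exact: rintegrableZ|exact: rintegrable_cst].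
rewrite RintZ // Rint_cst -!obj_sub // => le.
have : 2 * (obj h Y - obj h G) + rdist Z G ^+ 2 / 2 <= obj h Z - obj h G.
  apply: le => A; have := hY (h A).
  rewrite !(rdist_sym (h A)); lra.
lra.
Qed.

(** The two variance inequalities, each with factor 1/2, add up to exactly d(G, H)^2; the quadruple
    comparison bounds the same sum by 3 d(G, H) times the integral, and one factor d(G, H)
    cancels. *)
Lemma minimizer_dist h k G H : admissible h -> admissible k ->
  rintegrable (fun A => rdist (h A) (k A)) ->
  (forall Y, obj h G <= obj h Y) -> (forall Y, obj k H <= obj k Y) ->
  rdist G H <= 3 * E (fun A => rdist (h A) (k A)).
Proof.
move=> ah ak ihk Gmin Hmin.
have v1 := obj_variance H ah Gmin; have v2 := obj_variance G ak Hmin.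
rewrite (rdist_sym H G) in v1.
have ih := rintegrable_sqr_diff H G ah; have ik := rintegrable_sqr_diff G H ak.
have : (obj h H - obj h G) + (obj k G - obj k H) <=
    3 * rdist G H * E (fun A => rdist (h A) (k A)).
  rewrite !obj_sub // -RintD // -RintZ //; apply: le_Rint => [||A].
  - exact: rintegrableD.
  - exact: rintegrableZ.
  have := rdist_quadruple G H (k A) (h A); rewrite (rdist_sym (k A)); lra.
have i0 : 0 <= E (fun A => rdist (h A) (k A)) by apply: Rint_ge0 => A; exact: rdist_ge0.
have [->|gh] := eqVneq (rdist G H) 0; first by rewrite mulr_ge0.
have : 0 < rdist G H by rewrite lt_def gh rdist_ge0.
move: i0 v1 v2; move: (E _) (rdist G H) => c d i0 v1 v2 d0 le.
rewrite -(ler_pM2l d0); nra.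
Qed.

End Barycenters.

(** * The barycenter of a pushed measure along geodesics from a base point *)

Section GeodesicPush.
Local Open Scope sesquilinear_scope.
Variables (R : realType) (m : nat) (mu : probability (Pm R m) R).
Variable C : complexification R.
Local Notation P := (Pm R m).
Local Notation M := 'M[C]_m.
Local Notation E f := (Rintegral mu setT f).
Local Notation "x %:C" := (rc C x) : ring_scope.
Implicit Types (A B Y Z : P) (t : R).

Variables (pm : P -> M) (mk : forall H : M, gposdef H -> P).
Hypothesis pm_posdef : forall A, gposdef (pm A).
Hypothesis pm_inj : forall A B, pm A = pm B -> A = B.
Hypothesis pm_mk : forall H (pH : gposdef H), pm (mk pH) = H.
Hypothesis rdist_pdm : forall A B, rdist A B = pdm (pm A) (pm B).
Hypothesis rintegrable_rdist : forall Z, rintegrable mu (rdist Z).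

(** [L A] is the coordinate of A in the chart [cong V] centred at X, and [geo t] multiplies this
    coordinate by t. *)
Variables (X : P) (V : M) (L : P -> M) (geo : R -> P -> P).
Hypothesis Vu : V \in unitmx.
Hypothesis hL : forall A, herm (L A).
Hypothesis XE : pm X = cong V 0.
Hypothesis N_L_sub : forall A B, N (L A - L B) <= rdist A B.
Hypothesis N_L : forall A, N (L A) = rdist X A.
Hypothesis pm_geo : forall A t, pm (geo t A) = cong V (t%:C *: L A).

Lemma rdist_geo A s t : rdist (geo s A) (geo t A) = `|t - s| * rdist X A.
Proof.
rewrite rdist_pdm !pm_geo (pdm_geodesic s t Vu (hL A)).
by rewrite N_L.
Qed.

Lemma geo0 A : geo 0 A = X.
Proof. by apply: pm_inj; rewrite pm_geo rmorph0 scale0r -XE. Qed.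

Lemma geo_dcont t : dcontP (geo t).
Proof.
move=> A e e0; have [r r0 hr] := cong_cont Vu (hermZ t (hL A)) e0.
have t0 : 0 < `|t| + 1 by rewrite ltr_wpDl.
exists (r / (`|t| + 1)); first by rewrite divr_gt0.
move=> B; rewrite ltr_pdivlMr // => AB; rewrite rdist_pdm !pm_geo.
apply: hr (hermZ t (hL B)) _.
have -> : N (t%:C *: L B - t%:C *: L A) = `|t| * N (L A - L B).
  by rewrite -NZ N_subC -scalerBr.
have := N_L_sub A B; have := rdist_ge0 A B; have := normr_ge0 t.
move: AB; move: (N _) (rdist A B) `|t| => a b c; nra.
Qed.

Lemma geo_admissible t : admissible mu (geo t).
Proof.
split=> [|Z]; first exact: dcontP_measurable (geo_dcont t).
apply: (@rintegrable_dom _ _ _ _ (fun A => rdist Z X + `|t| * rdist X A)).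
- apply: dcont_measurable; apply: (dcont_comp _ (geo_dcont t)).
  apply: dcont_lip => A B.
  by rewrite (rdist_sym Z A) (rdist_sym Z B); exact: rdist_diff.
- apply: rintegrableD; first exact: rintegrable_cst.
  by apply: rintegrableZ; exact: rintegrable_rdist.
- move=> A; rewrite ger0_norm ?rdist_ge0 //.
  apply: le_trans (rdist_triangle _ _ X) _; rewrite lerD2l.
  by rewrite -{1}(geo0 A) rdist_geo subr0.
Qed.

Variable beta : R -> P.
Hypothesis beta_min : forall t Z, obj mu (geo t) (beta t) <= obj mu (geo t) Z.

Lemma beta_lipschitz s t : rdist (beta s) (beta t) <= 3 * E (rdist X) * `|s - t|.
Proof.
have EE : E (fun A => rdist (geo s A) (geo t A)) = `|s - t| * E (rdist X).
  rewrite -RintZ; last exact: rintegrable_rdist.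
  by apply: eq_Rintegral => A _; rewrite rdist_geo distrC.
rewrite -mulrA [_ * `|_|]mulrC -EE.
apply: minimizer_dist; try exact: geo_admissible; try exact: beta_min.
have -> : (fun A => rdist (geo s A) (geo t A)) = (fun A => `|t - s| * rdist X A).
  by apply/funext => A; rewrite rdist_geo.
by apply: rintegrableZ; exact: rintegrable_rdist.
Qed.

Definition mean_log : M :=
  \matrix_(i, j) mkc C (E (fun A => re (L A i j))) (E (fun A => im (L A i j))).

Local Notation K := mean_log.

Lemma rintegrable_re i j : rintegrable mu (fun A => re (L A i j)).
Proof.
apply: (@rintegrable_dom _ _ _ _ (rdist X)) => [||A]; last first.
- by rewrite -N_L; have [] := N_entry (L A) i j.
- exact: rintegrable_rdist.
apply: dcont_measurable; apply: dcont_lip => A B.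
exact: le_trans (re_entry_le _ _ _ _) (N_L_sub A B).
Qed.

Lemma rintegrable_im i j : rintegrable mu (fun A => im (L A i j)).
Proof.
apply: (@rintegrable_dom _ _ _ _ (rdist X)) => [||A]; last first.
- by rewrite -N_L; have [] := N_entry (L A) i j.
- exact: rintegrable_rdist.
apply: dcont_measurable; apply: dcont_lip => A B.
exact: le_trans (im_entry_le _ _ _ _) (N_L_sub A B).
Qed.

Lemma herm_mean : herm K.
Proof.
apply/matrixP => i j; rewrite !mxE; apply: re_im_inj.
  rewrite re_conj !re_mkc; apply: eq_Rintegral => A _.
  by rewrite -{1}(hL A) !mxE re_conj.
rewrite im_conj !im_mkc -[RHS]opprK; congr (- _).
rewrite -mulN1r -RintZ; last exact: rintegrable_im.
by apply: eq_Rintegral => A _; rewrite -{1}(hL A) !mxE im_conj mulN1r.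
Qed.

Definition centered (f : P -> R) := rintegrable mu f /\ E f = 0.

Lemma centered_sum (I : finType) (F : I -> P -> R) :
  (forall i, centered (F i)) -> centered (fun A => \sum_i F i A).
Proof.
move=> hF; elim: (index_enum I) => [|i s [IH1 IH2]].
  have -> : (fun A => \sum_(i <- [::]) F i A) = (fun=> 0).
    by apply/funext => A; rewrite big_nil.
  by split; [exact: rintegrable_cst|exact: Rint_cst].
have -> : (fun A => \sum_(j <- i :: s) F j A) =
    (fun A => F i A + \sum_(j <- s) F j A).
  by apply/funext => A; rewrite big_cons.
have [h1 h2] := hF i; split; first exact: rintegrableD.
by rewrite RintD // h2 IH2 addr0.
Qed.

(** The mean is defined entrywise, so the inner product is written as a finite real combination of
    centred real and imaginary parts. *)
Lemma centered_ip (H : M) : centered (fun A => ip H (L A - K)).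
Proof.
have cE (c : R) f : rintegrable mu f -> centered (fun A => c * (f A - E f)).
  move=> hf; have hd : rintegrable mu (fun A => f A - E f).
    by apply: rintegrableB => //; exact: rintegrable_cst.
  split; first exact: rintegrableZ.
  rewrite RintZ // RintB //; last exact: rintegrable_cst.
  by rewrite Rint_cst subrr mulr0.
have -> : (fun A => ip H (L A - K)) = (fun A => \sum_i \sum_j
    (re (H i j) * (re (L A i j) - E (fun A => re (L A i j))) +
     im (H i j) * (im (L A i j) - E (fun A => im (L A i j))))).
  apply/funext => A; rewrite ipE; apply: eq_bigr => i _; apply: eq_bigr => j _.
  by rewrite !mxE reD imD reN imN re_mkc im_mkc.
apply: centered_sum => i; apply: centered_sum => j.
have [a1 a2] := cE (re (H i j)) _ (rintegrable_re i j).
have [b1 b2] := cE (im (H i j)) _ (rintegrable_im i j).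
split; first exact: rintegrableD.
by rewrite RintD // a2 b2 addr0.
Qed.

Let D t A := trotter_err K t (L A).

Lemma D_ge0 t A : 0 <= D t A. Proof. exact: N_ge0. Qed.

Lemma D_le t A : D t A <= 2 * `|t| * (rdist X A + N K).
Proof. by rewrite -N_L; exact: (trotter_err_le t Vu herm_mean (hL A)). Qed.

Lemma D_integrable t : rintegrable mu (D t).
Proof.
apply: (@rintegrable_dom _ _ _ _ (fun A => 2 * `|t| * (rdist X A + N K))).
- apply: dcont_measurable => A e e0.
  have e2 : 0 < e / 2 by rewrite divr_gt0.
  have [r r0 hr] := geo_dcont t A e2.
  have t0 : 0 < `|t| + 1 by rewrite ltr_wpDl.
  exists (Order.min r (e / 2 / (`|t| + 1))); first by rewrite lt_min r0 divr_gt0.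
  move=> B; rewrite lt_min => /andP[/hr h1]; rewrite ltr_pdivlMr // => h2.
  have := trotter_err_lip t Vu herm_mean (hL A) (hL B).
  rewrite -!pm_geo -rdist_pdm -/(D t A) -/(D t B) => h3.
  apply: le_lt_trans h3 _.
  have := N_L_sub A B; have := rdist_ge0 A B; have := normr_ge0 t.
  move: h1 h2; move: (N _) (rdist A B) (rdist _ _) `|t| => a b c d; nra.
- apply: rintegrableZ; apply: rintegrableD; last exact: rintegrable_cst.
  exact: rintegrable_rdist.
- by move=> A; rewrite ger0_norm ?D_ge0 // D_le.
Qed.

(** Comparing beta(t) with g = gamma(t) in the integrated law of cosines gives |H|^2 - 2 |H| int D
    <= obj(beta(t)) - obj(g) <= 0; then |H| is cancelled. *)
Lemma beta_repr t : exists H : M, [/\ herm H,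
  pm (beta t) = cong (V *m gexp ((t / 2)%:C *: K)) H & N H <= 2 * E (D t)].
Proof.
have hK := herm_mean.
have [H [hH bE cos]] := cosine_law t Vu hK (pm_posdef (beta t)).
exists H; split=> //.
pose g : P := mk (gposdef_cong (t%:C *: K) Vu).
have gE : pm g = cong V (t%:C *: K) by exact: pm_mk.
have ah := geo_admissible t.
have [ic c0] := centered_ip H.
have iD := D_integrable t.
have i1 : rintegrable mu (fun A => 2 * N H * D t A) by exact: rintegrableZ.
have i2 : rintegrable mu (fun A => 2 * t * ip H (L A - K)) by exact: rintegrableZ.
have i3 : rintegrable mu (fun=> N H ^+ 2) by exact: rintegrable_cst.
have i4 := rintegrableB i3 i1.
have : E (fun A => N H ^+ 2 - 2 * N H * D t A - 2 * t * ip H (L A - K)) <=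
    obj mu (geo t) (beta t) - obj mu (geo t) g.
  rewrite obj_sub //; apply: le_Rint => [||A].
  - exact: rintegrableB.
  - exact: rintegrable_sqr_diff.
  have := cos (L A) (hL A); rewrite -gE -pm_geo -!rdist_pdm -/(D t A); lra.
rewrite RintB // RintB // Rint_cst !RintZ // c0 mulr0 subr0 => le.
have le0 := beta_min t g.
have [->|n0] := eqVneq (N H) 0; first by rewrite mulr_ge0 // Rint_ge0 // => A; exact: D_ge0.
have np : 0 < N H by rewrite lt_def n0 N_ge0.
rewrite -(ler_pM2l np).
move: le le0 np; move: (E (D t)) (N H) (obj _ _ _) (obj _ _ _) => a b c d; nra.
Qed.

(** Dominated convergence concerns sequences, so a failure of the estimate is turned into parameters
    u_n with |u_n| < 1/(n + 1), along which D / |u_n| tends to 0 pointwise under an integrable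
    majorant. *)
Lemma D_small (e : R) : 0 < e ->
  exists2 d : R, 0 < d & forall t, `|t| < d -> E (D t) <= e * `|t|.
Proof.
move=> e0; apply: contrapT => no.
have bad n : exists t, `|t| < n.+1%:R^-1 /\ e * `|t| < E (D t).
  apply: contrapT => nb; apply: no; exists n.+1%:R^-1; first by rewrite invr_gt0.
  move=> t tn; rewrite leNgt; apply/negP => h; apply: nb; by exists t.
pose u n := sval (cid (bad n)).
have uP n : `|u n| < n.+1%:R^-1 /\ e * `|u n| < E (D (u n)) by exact: (svalP (cid (bad n))).
(* The parameter 0 cannot violate the estimate, since [D 0] vanishes identically; division by |u_n|
   is therefore legitimate. *)
have u0 n : 0 < `|u n|.
  rewrite normr_gt0; apply/eqP => un0; have [_] := uP n.
  rewrite un0 normr0 mulr0 ltNge => /negP; apply.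
  rewrite -[leRHS](Rint_cst mu 0); apply: le_Rint; [exact: D_integrable|exact: rintegrable_cst|].
  by move=> A; have := D_le 0 A; rewrite normr0 mulr0 mul0r.
pose f n (A : P) := `|u n|^-1 * D (u n) A.
have fi n : rintegrable mu (f n) by apply: rintegrableZ; exact: D_integrable.
have f0 n A : 0 <= f n A by rewrite mulr_ge0 ?invr_ge0 ?D_ge0.
pose g (A : P) := 2 * (rdist X A + N K).
have gi : rintegrable mu g.
  apply: rintegrableZ; apply: rintegrableD; last exact: rintegrable_cst.
  exact: rintegrable_rdist.
have fg n A : f n A <= g A.
  have := D_le (u n) A; rewrite /f /g; move: (D (u n) A) (u0 n) => x un0 h.
  by rewrite mulrC ler_pdivrMr //; lra.
have fcvg A : (fun n => f n A) @ \oo --> (0 : R).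
  have [c [d [c0 d0 h]]] := lie_trotter (hL A) herm_mean.
  have vanish : (fun n => c * harmonic n) @ \oo --> (0 : R).
    by rewrite -[X in _ --> X](mulr0 c); apply: cvgMr; exact: cvg_harmonic.
  apply: (squeeze_cvgr _ (cvg_cst 0) vanish).
  have /cvgrPdist_lt/(_ d d0) := @cvg_harmonic R; apply: filterS => n.
  have hn : 0 <= harmonic n :> R by rewrite /harmonic /= invr_ge0.
  rewrite sub0r normrN (ger0_norm hn) => nd; rewrite f0 /=.
  have [un _] := uP n.
  have := h (u n) (lt_trans un nd).
  rewrite -/(shift_log K (u n) (L A)) -/(trotter_err K (u n) (L A)) -/(D (u n) A) => hD.
  rewrite /f; move: (D (u n) A) hD => x hD.
  rewrite mulrC ler_pdivrMr //; apply: le_trans hD _.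
  have -> : u n ^+ 2 = `|u n| * `|u n| by rewrite -real_normK ?num_real // expr2.
  by rewrite mulrA; apply: ler_wpM2r => //; apply: ler_wpM2l => //; exact: ltW.
have dom : {ae mu, forall x n, setT x -> (`|(f n x)%:E| <= (g x)%:E)%E}.
  by apply: aeW => A n _; rewrite /= lee_fin ger0_norm.
have ptw : {ae mu, forall x, setT x -> (fun n => (f n x)%:E) @ \oo --> (0%:E : \bar R)}.
  by apply: aeW => A _; apply/fine_cvgP; split; [exact: nearW|exact: fcvg].
have [_ _ dct] := dominated_convergence measurableT
  (fun n => measurable_int _ (fi n)) (measurable_cst _) ptw gi dom.
have : (fun n => E (f n)) @ \oo --> (0 : R).
  rewrite -[X in _ --> X](Rint_cst mu 0); apply: fine_cvg.
  rewrite fineK; first exact: dct.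
  exact: integrable_fin_num (rintegrable_cst mu 0).
move=> /cvgrPdist_lt/(_ e e0) [n0 _ /(_ n0 (leqnn _))] /=.
rewrite sub0r normrN ger0_norm; last exact: Rint_ge0.
have [_] := uP n0; rewrite /f RintZ; last exact: D_integrable.
by move: (E _) (u0 n0) => x un0 h1; rewrite mulrC ltr_pdivrMr // => h2; have := lt_trans h1 h2; rewrite ltxx.
Qed.

(** The estimate [D_small] includes t = 0, where it forces the coordinate H of beta(0) to vanish. *)
Lemma pm_beta0 : pm (beta 0) = pm X.
Proof.
have [H [hH -> NH]] := beta_repr 0.
have [d d0 hd] := D_small ltr01.
have := hd 0; rewrite normr0 mulr0 => /(_ d0) D0.
have H0 : H = 0 by apply: N0_eq0; apply/eqP; rewrite eq_le N_ge0 andbT; lra.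
by rewrite H0 mul0r rmorph0 scale0r gexp0 mulmx1 XE.
Qed.

Lemma beta_derivative :
  (fun h : R => (h%:C)^-1 *: (pm (beta (0 + h)) - pm (beta 0)) :
    ('M[C]_m : normedModType C)) @ 0^' -->
  (V *m K *m V ^t* : ('M[C]_m : normedModType C)).
Proof.
have [c c0 hc] := cong_derivative V herm_mean.
apply: cvg_N => e e0.
(* With |h| < e' and |H| <= 2 e' |h|, the remainder c (h^2 + |H|) is at most 3 c e' |h|, hence below
   4 (c + 1) e' |h| = e |h|. The bound (2 e' + 1)^{-1} on |h| ensures |H| <= 1. *)
have c1 : 0 < 4 * (c + 1) by rewrite mulr_gt0 // ltr_wpDl.
pose e' := e / (4 * (c + 1)); have e0' : 0 < e' by rewrite divr_gt0.
have [d d0 hd] := D_small e0'.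
have e1 : 0 < 2 * e' + 1 by rewrite ltr_wpDl // mulr_ge0 // ltW.
have hmin : 0 < Order.min d (Order.min 1 (Order.min e' (2 * e' + 1)^-1)).
  by rewrite !lt_min d0 ltr01 e0' invr_gt0.
near=> h.
have h0 : h != 0 by near: h; exact: nbhs_dnbhs_neq.
have : `|h| < Order.min d (Order.min 1 (Order.min e' (2 * e' + 1)^-1)).
  by near: h; exact: dnbhs0_lt.
rewrite !lt_min => /and4P[hd' h1 he' h2].
rewrite N_div_t // add0r; have [H [hH bE NH]] := beta_repr h.
have hp : 0 < `|h| by rewrite normr_gt0.
have Dh := hd h hd'.
have NH' : N H <= 2 * e' * `|h| by lra.
have NH1 : N H <= 1.
  apply: le_trans NH' _.
  have : `|h| * (2 * e' + 1) < 1 by rewrite -ltr_pdivlMr ?div1r.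
  nra.
have := hc h H (ltW h1) hH NH1; rewrite -bE -XE -pm_beta0 => le.
rewrite mulrC ltr_pdivrMr //; apply: le_lt_trans le _.
have ce : e' * (4 * (c + 1)) = e by rewrite mulfVK // gt_eqF.
have hh : h ^+ 2 = `|h| * `|h| by rewrite -real_normK ?num_real // expr2.
rewrite hh -ce; move: hp he' NH'; move: `|h| (N H) => a b hp he' NH'.
have : c * (a * a + b) <= c * (3 * e' * a).
  by rewrite ler_wpM2l //; nra.
nra.
Unshelve. all: end_near. Qed.

End GeodesicPush.

(** * Specialisation to V = X^{1/2} and to the barycenter *)

Section Concrete.
Variables (R : realType) (m : nat) (X : Pm R m) (mu : probability (Pm R m) R).
Hypothesis hmu : finite_first_moment mu.
Local Notation cm := (complex_model R).
Local Notation P := (Pm R m).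
Local Notation M := 'M[cm]_m.
Local Notation "x %:C" := (rc cm x) : ring_scope.
Implicit Types (A B Y Z : P) (t : R).

Local Notation V := (gpow (pm X) 2^-1).

Local Notation L := (fun A : P => rlog (pm X) (pm A)).

Lemma rintegrable_rdist Z : rintegrable mu (rdist Z).
Proof.
have rm Y : measurable_fun setT (rdist Y).
  apply: dcont_measurable; apply: dcont_lip => A B.
  by rewrite (rdist_sym Y A) (rdist_sym Y B); exact: rdist_diff.
have [Y hY] := hmu; have iY : rintegrable mu (rdist Y).
  apply/integrableP; split; first exact/measurable_EFinP.
  apply: le_lt_trans hY; rewrite le_eqVlt; apply/orP; left; apply/eqP.
  apply: eq_integral => A _ /=.
  by rewrite ger0_norm ?rdist_ge0 // rdist_sym rdistE.
apply: (@rintegrable_dom _ _ _ _ (fun A => rdist Z Y + rdist Y A)) => //.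
  by apply: rintegrableD => //; exact: rintegrable_cst.
by move=> A; rewrite ger0_norm ?rdist_ge0 // rdist_triangle.
Qed.

Lemma geomeanE A t :
  geomean (pval X) (pval A) t = cong V (t%:C *: rlog (pm X) (pm A)).
Proof.
rewrite -(ggeomeanE t (pm_posdef X) (pm_posdef A)).
by rewrite /geomean !mpow_gpow.
Qed.

Lemma pm_geomap A t : pm (geomap X t A) = cong V (t%:C *: rlog (pm X) (pm A)).
Proof.
have [Vu _ _ _] := gpow_half (pm_posdef X).
have pG : posdef (geomean (pval X) (pval A) t).
  have : gposdef (cong V (t%:C *: rlog (pm X) (pm A))) by exact: gposdef_cong.
  by rewrite -geomeanE.
(* The geometric mean is positive definite, so [insubd] returns it and not its default X. *)
rewrite -geomeanE; apply: (etrans (val_insubd _ _)).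
by rewrite (asboolT pG).
Qed.

Let XE : pm X = cong V 0. Proof. by have [] := gpow_half (pm_posdef X). Qed.

Let Vu : V \in unitmx. Proof. by have [] := gpow_half (pm_posdef X). Qed.

Let hL A : herm (rlog (pm X) (pm A)). Proof. exact: herm_rlog. Qed.

Let N_L_sub A B : N (rlog (pm X) (pm A) - rlog (pm X) (pm B)) <= rdist A B.
Proof.
by rewrite rdist_pdm; exact: (N_rlog_sub (pm_posdef X) (pm_posdef A) (pm_posdef B)).
Qed.

Let N_L A : N (rlog (pm X) (pm A)) = rdist X A.
Proof. by rewrite rdist_pdm; exact: (N_rlog (pm_posdef X) (pm_posdef A)). Qed.

Lemma geomap_admissible t : admissible mu (geomap X t).
Proof.
exact: (@geo_admissible R m mu cm (@pm R m) (@pm_inj R m) (@rdist_pdm R m)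
  rintegrable_rdist X V L (geomap X) Vu hL XE N_L_sub N_L pm_geomap t).
Qed.

Lemma cartan_objE t Z : cartan_obj (geopush X t mu) Z = obj mu (geomap X t) Z.
Proof.
have ah := geomap_admissible t.
rewrite /cartan_obj /rint /geopush /obj /Rintegral -rdistE; congr fine.
apply: (etrans (integral_pushforward ah.1 _ _ _)) => //; last first.
  exact: (rintegrable_sqr_diff Z (PD1 R m : P) ah).
have md Y : measurable_fun setT (rdist Y).
  exact: rintegrable_measurable (rintegrable_rdist Y).
apply/measurable_EFinP; apply: measurable_funB; exact: measurable_funX.
Qed.

Let beta t : P := barycenter (geopush X t mu).

(** A minimiser exists, so [xget] selects one and not its default, the identity. *)
Lemma barycenter_min t Z : obj mu (geomap X t) (beta t) <= obj mu (geomap X t) Z.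
Proof.
have [G Gmin] := obj_minimizer (geomap_admissible t).
have ex : [set G : P | forall Z, cartan_obj (geopush X t mu) G <=
    cartan_obj (geopush X t mu) Z] !=set0.
  by exists G => Y; rewrite !cartan_objE.
by have := xgetPex (PD1 R m : P) ex Z; rewrite -/(beta t) !cartan_objE.
Qed.

Lemma barycenter_locally_lipschitz : locally_lipschitz beta.
Proof.
(* The estimate is global in s and t, so the radius 1 is arbitrary; the constant is 3 times the mean
   distance to X. *)
move=> t0; exists 1 => //; exists (3 * Rintegral mu setT (rdist X)) => s t _ _.
rewrite -rdistE.
exact: (@beta_lipschitz R m mu cm (@pm R m) (@pm_inj R m) (@rdist_pdm R m)
  rintegrable_rdist X V L (geomap X) Vu hL XE N_L_sub N_L pm_geomap beta barycenter_min).
Qed.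

Lemma mean_logE : mint mu (fun A => mlog (mpow (pval X) (- 2^-1) *m pval A
    *m mpow (pval X) (- 2^-1))) = mean_log mu L.
Proof.
have logE A : mlog (mpow (pval X) (- 2^-1) *m pval A *m mpow (pval X) (- 2^-1)) =
    rlog (pm X) (pm A) by rewrite mlogE !mpow_gpow.
apply/matrixP => i j; rewrite [LHS]mxE [RHS]mxE.
congr Complex; apply: eq_Rintegral => A _ /=; by rewrite logE.
Qed.

Lemma barycenter_deriv : mx_deriv_at (fun t => pval (beta t)) 0
  (mpow (pval X) (2^-1)
    *m mint mu (fun A => mlog (mpow (pval X) (- 2^-1) *m pval A
                                *m mpow (pval X) (- 2^-1)))
    *m mpow (pval X) (2^-1)).
Proof.
rewrite mean_logE !mpow_gpow.
have [_ hV _ _] := gpow_half (pm_posdef X).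
have := @beta_derivative R m mu cm (@pm R m) (@mkPm R m) (@pm_posdef R m)
  (@pm_inj R m) (fun H pH => erefl) (@rdist_pdm R m)
  rintegrable_rdist X V L (geomap X) Vu hL XE N_L_sub N_L pm_geomap beta barycenter_min.
by rewrite hV.
Qed.

End Concrete.

Unset Implicit Arguments.
Set Strict Implicit.

Theorem theorem1p2 (R : realType) (m : nat) (X : Pm R m)
    (mu : probability (Pm R m) R) (hmu : finite_first_moment mu) :
  let beta := fun t : R => barycenter (geopush X t mu) in
  locally_lipschitz beta /\
  mx_deriv_at (fun t => pval (beta t)) 0
  (mpow (pval X) (2^-1)
    *m mint mu (fun A => mlog (mpow (pval X) (- 2^-1) *m pval A
                                *m mpow (pval X) (- 2^-1)))
    *m mpow (pval X) (2^-1)).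
Proof.
split; first exact: barycenter_locally_lipschitz.
exact: barycenter_deriv.
Qed.
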